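(* Let $A$ be a $C^*$-algebra with a tracial state $\tau$, generated by two isometries $S_1,S_2$, such that the dense $*$-subalgebra $\mathcal{A}$ generated by $S_1,S_2$ admits derivations $\partial_1,\partial_2$ with $\partial_i(S_j)=\delta_{ij}S_i$ and $\partial_i(S_j^* )=-\delta_{ij}S_j^*$, and consider the canonical calculus of rank two on $\mathcal{A}$. If this calculus satisfies the Gauss-Bonnet theorem, i.e. if $\int_\tau\Omega_{12}^k$ is independent of the smooth deformation parameter $k$, then $\int_\tau\Omega_{12}^k=0$ for all smooth deformation parameters $k$.
   Context: A smooth deformation parameter is an invertible element $k\in A$ with $k,k^{-1}\in\mathcal{A}$. General notions. A differential calculus on a complex algebra $\mathcal{A}$ is a differential graded algebra $(\Omega(\mathcal{A}),\wedge,d)$ with $\Omega^0(\mathcal{A})=\mathcal{A}$, generated in degree zero. It is quasi-tame if $\Omega^1(\mathcal{A})$ is a finitely generated projective right module, $\Omega^1(\mathcal{A})\otimes_{\mathcal{A}}\Omega^1(\mathcal{A})=\mathrm{Ker}(\wedge)\oplus\mathcal{F}$ as right modules with $\mathcal{F}\cong\Omega^2(\mathcal{A})$, and the idempotent $P_{\rm sym}$ with range $\mathrm{Ker}(\wedge)$ and kernel $\mathcal{F}$ is a bimodule map; put $\sigma=2P_{\rm sym}-1$. It is tame if moreover $\mathcal{Z}(\Omega^1(\mathcal{A}))\otimes_{\mathcal{Z}(\mathcal{A})}\mathcal{A}\to\Omega^1(\mathcal{A})$, $\sum e_i\otimes a_i\mapsto\sum e_ia_i$, is an isomorphism ($\mathcal{Z}$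 denotes center) and $\sigma(\omega\otimes\eta)=\eta\otimes\omega$ for central $\omega,\eta$. A pseudo-Riemannian metric is a right $\mathcal{A}$-linear $g:\Omega^1(\mathcal{A})\otimes_{\mathcal{A}}\Omega^1(\mathcal{A})\to\mathcal{A}$ with $g\circ\sigma=g$ and $\omega\mapsto g(\omega\otimes\,\cdot\,)$ an isomorphism $\Omega^1(\mathcal{A})\to\mathrm{Hom}_{\mathcal{A}}(\Omega^1(\mathcal{A}),\mathcal{A})$; it is strongly $\sigma$-compatible if its values on pairs of central one-forms commute with each other. A connection is a $\mathbb{C}$-linear $\nabla:\Omega^1(\mathcal{A})\to\Omega^1(\mathcal{A})\otimes_{\mathcal{A}}\Omega^1(\mathcal{A})$ with $\nabla(ea)=\nabla(e)a+e\otimes da$; it is Levi-Civita for $g$ if $\wedge\circ\nabla+d=0$ and $\Pi_g(\nabla)=d\circ g$, where $\Pi_g(\nabla)(\omega\otimes\eta a)=(g\otimes\mathrm{id})\sigma_{23}(\nabla(\omega)\otimes\eta+\nabla(\eta)\otimes\omega)\,a+g(\omega\otimes\eta)\,da$ for central $\omega,\eta$ and $a\in\mathcal{A}$, $\sigma_{23}=\mathrm{id}\otimes\sigma$. On a tame calculus admitting a bilinear metric, each strongly $\sigma$-compatible metric has a unique Levi-Civita connection (known). Canonical calculus of rank two. Fix a faithful state $\tau_0$ on $A$, let $\mathcal{D}=\partial_1\otimes\gamma_1+\partial_2\otimes\gamma_2$ on $L^2(A,\tau_0)\otimes\mathbb{C}^2$, with $\gamma_i^2=1$, $\gamma_1\gamma_2=-\gamma_2\gamma_1$,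 and $a\in\mathcal{A}$ acting as $a\otimes1$. The calculus is Connes' calculus $\Omega^k(\mathcal{A})=\Pi(\Omega^k_u(\mathcal{A}))/\Pi(\delta J_0^{k-1})$, where $(\Omega^\bullet_u(\mathcal{A}),\delta)$ is the reduced universal differential graded algebra, $\Pi(a_0\delta a_1\cdots\delta a_k)=a_0[\mathcal{D},a_1]\cdots[\mathcal{D},a_k]$, $J_0^k=\ker\Pi|_{\Omega_u^k(\mathcal{A})}$. It is tame; $\Omega^1(\mathcal{A})$ is the free bimodule with central basis $e_i=1\otimes\gamma_i$, $d(a)=\sum_ie_i\partial_i(a)$, $d(e_i)=0$, $e_i\wedge e_j=-e_j\wedge e_i$, and $\Omega^2(\mathcal{A})$ is free of rank one with basis $e_1\wedge e_2$. Its canonical bilinear metric is $g_0(\sum_{i,j} e_i\otimes e_ja_{ij})=\sum_ia_{ii}$. Gauss-Bonnet form. For a smooth deformation parameter $k$, $kg_0$ is the strongly $\sigma$-compatible metric $kg_0(\sum_{i,j} e_i\otimes e_ja_{ij})=\sum_i ka_{ii}$. With the Christoffel symbols of its Levi-Civita connection $\nabla$ defined by $\nabla(e_i)=\sum_{j,l}e_j\otimes e_l\Gamma^i_{jl}$, put $$\Omega^k_{12}=e_1\wedge e_2\Big(\sum_{p=1}^2(\Gamma^p_{21}\Gamma^1_{p2}-\Gamma^p_{22}\Gamma^1_{p1})-\partial_2(\Gamma^1_{21})+\partial_1(\Gamma^1_{22})\Big).$$ For $\theta=e_1\wedge e_2\,a\in\Omega^2(\mathcal{A})$ with $a\in\mathcal{A}$,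 put $\int_\tau\theta:=\tau(a)$. *)

(* Defs.v *)
From HB Require Import structures.
From mathcomp Require Import all_boot all_order all_algebra.
From mathcomp Require Import complex.
From mathcomp Require Import all_classical all_reals all_analysis.

Set Implicit Arguments.
Unset Strict Implicit.
Unset Printing Implicit Defensive.

Import Order.TTheory GRing.Theory Num.Theory.
Import numFieldNormedType.Exports.

Local Open Scope classical_set_scope.
Local Open Scope ring_scope.
Local Open Scope quotient_scope.

(* [zmodType]s carrying two commuting actions of [B]; the scalars of the
   ground field act in the same way on both sides. *)
HB.mixin Record Zmodule_isBimodule (K : fieldType) (B : algType K) M
    of GRing.Zmodule M := {
  lact : B -> M -> M;
  ract : M -> B -> M;
  lactDr : forall a, {morph lact a : x y / x + y};
  lactDl : forall x, {morph lact^~ x : a b / a + b};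
  lact1 : forall x, lact 1 x = x;
  lactA : forall a b x, lact a (lact b x) = lact (a * b) x;
  ractDl : forall a, {morph ract^~ a : x y / x + y};
  ractDr : forall x, {morph ract x : a b / a + b};
  ract1 : forall x, ract x 1 = x;
  ractA : forall a b x, ract (ract x a) b = ract x (a * b);
  lractA : forall a b x, ract (lact a x) b = lact a (ract x b);
  lract_scalar : forall (c : K) x, lact c%:A x = ract x c%:A
}.

#[short(type="bimodType")]
HB.structure Definition Bimodule (K : fieldType) (B : algType K) :=
  { M of GRing.Zmodule M & Zmodule_isBimodule K B M }.

Section BimoduleTheory.
Context (K : fieldType) (B : algType K) (M : bimodType B).
Implicit Types (x : M) (a : B).

Lemma lact0r a : lact a (0 : M) = 0.
Proof. by apply: (addIr (lact a 0)); rewrite -lactDr !add0r. Qed.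

Lemma lactNr a x : lact a (- x) = - lact a x.
Proof. by apply: (addIr (lact a x)); rewrite -lactDr !addNr lact0r. Qed.

Lemma ract0l a : ract (0 : M) a = 0.
Proof. by apply: (addIr (ract (0 : M) a)); rewrite -ractDl !add0r. Qed.

Lemma ractNl a x : ract (- x) a = - ract x a.
Proof. by apply: (addIr (ract x a)); rewrite -ractDl !addNr ract0l. Qed.

Lemma lact_sum I (r : seq I) (F : I -> M) a :
  lact a (\sum_(i <- r) F i) = \sum_(i <- r) lact a (F i).
Proof. exact: (big_morph _ (lactDr a) (lact0r a)). Qed.

Lemma ract_sum I (r : seq I) (F : I -> M) a :
  ract (\sum_(i <- r) F i) a = \sum_(i <- r) ract (F i) a.
Proof. exact: (big_morph _ (ractDl a) (ract0l a)). Qed.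

End BimoduleTheory.

Section Tensor.
Context (K : Type) (M N : zmodType) (rM : M -> K -> M) (lN : K -> N -> N).

Record balanced (G : zmodType) (f : M -> N -> G) : Prop := Balanced {
  balancedDl : forall m m' n, f (m + m') n = f m n + f m' n;
  balancedDr : forall m n n', f m (n + n') = f m n + f m n';
  balancedM : forall m k n, f (rM m k) n = f m (lN k n) }.

Definition tens_eval (G : zmodType) (f : M -> N -> G) (s : seq (M * N)) : G :=
  \sum_(p <- s) f p.1 p.2.

(* Finite formal sums of pairs, two of them being identified when no balanced
   map into an abelian group tells them apart.  This is the quotient of the
   formal sums by the usual relations, because the map into that quotient is
   itself balanced. *)
Definition tens_rel (s t : seq (M * N)) : bool :=
  `[< forall (G : zmodType) (f : M -> N -> G),
        balanced f -> tens_eval f s = tens_eval f t >].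

Lemma tens_rel_equiv : equiv_class_of tens_rel.
Proof.
split=> [s|s t|t s u].
- by apply/asboolP.
- by apply/asboolP/asboolP=> h G f bf; rewrite h.
- by move=> /asboolP h1 /asboolP h2; apply/asboolP=> G f bf; rewrite h1 // h2.
Qed.

Canonical tens_rel_canonical := EquivRelPack tens_rel_equiv.
Canonical tens_rel_encModRel := defaultEncModRel tens_rel.

Definition tensor : Type := {eq_quot tens_rel}.
HB.instance Definition _ := Choice.on tensor.
HB.instance Definition _ : EqQuotient _ tens_rel tensor :=
  EqQuotient.on tensor.

Lemma tensP (s t : seq (M * N)) :
  \pi_tensor s = \pi_tensor t <->
  forall (G : zmodType) (f : M -> N -> G),
    balanced f -> tens_eval f s = tens_eval f t.
Proof.
split.
  by move/eqP; rewrite piE => /asboolP.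
by move=> h; apply/eqP; rewrite piE; apply/asboolP.
Qed.

Lemma tens_reprP (s : seq (M * N)) (G : zmodType) (f : M -> N -> G) :
  balanced f -> tens_eval f (repr (\pi_tensor s)) = tens_eval f s.
Proof. by apply/tensP: G f; rewrite reprK. Qed.

Lemma tens_eval_cat (G : zmodType) (f : M -> N -> G) s t :
  tens_eval f (s ++ t) = tens_eval f s + tens_eval f t.
Proof. by rewrite /tens_eval big_cat. Qed.

Definition tens_opp (s : seq (M * N)) := [seq (- p.1, p.2) | p <- s].

Lemma tens_eval_opp (G : zmodType) (f : M -> N -> G) s :
  balanced f -> tens_eval f (tens_opp s) = - tens_eval f s.
Proof.
move=> bf; rewrite /tens_eval big_map -sumrN; apply: eq_bigr => p _ /=.
have f0 n : f 0 n = 0.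
  by apply: (addIr (f 0 n)); rewrite -(balancedDl bf) !add0r.
by apply: (addIr (f p.1 p.2)); rewrite -(balancedDl bf) !addNr f0.
Qed.

Definition tensor_zero : tensor := \pi_tensor [::].
Definition tensor_add (x y : tensor) : tensor := \pi_tensor (repr x ++ repr y).
Definition tensor_opp (x : tensor) : tensor := \pi_tensor (tens_opp (repr x)).

Lemma tensor_addA : associative tensor_add.
Proof.
move=> x y z; apply/tensP=> G f bf.
by rewrite !(tens_eval_cat, tens_reprP _ bf) addrA.
Qed.

Lemma tensor_addC : commutative tensor_add.
Proof. by move=> x y; apply/tensP=> G f bf; rewrite !tens_eval_cat addrC. Qed.

Lemma tensor_add0 : left_id tensor_zero tensor_add.
Proof.
move=> x; rewrite -[RHS]reprK; apply/tensP=> G f bf.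
by rewrite tens_eval_cat tens_reprP // {1}/tens_eval big_nil add0r.
Qed.

Lemma tensor_addN : left_inverse tensor_zero tensor_opp tensor_add.
Proof.
move=> x; apply/tensP=> G f bf.
by rewrite tens_eval_cat tens_reprP // tens_eval_opp // addNr /tens_eval big_nil.
Qed.

HB.instance Definition _ := GRing.isZmodule.Build tensor
  tensor_addA tensor_addC tensor_add0 tensor_addN.

Definition tens (m : M) (n : N) : tensor := \pi_tensor [:: (m, n)].

(* Independent of the choice of representative when [f] is balanced. *)
Definition tens_lift (G : zmodType) (f : M -> N -> G) (x : tensor) : G :=
  tens_eval f (repr x).

Lemma pi_tensorE (s : seq (M * N)) :
  \pi_tensor s = \sum_(p <- s) tens p.1 p.2.
Proof.
elim: s => [|[m n] s IHs]; first by rewrite big_nil.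
rewrite big_cons -IHs; apply/tensP=> G f bf.
by rewrite -cat1s !(tens_eval_cat, tens_reprP _ bf).
Qed.

Lemma tens_balanced : balanced tens.
Proof.
by split=> [m m' n|m n n'|m k n]; apply/tensP=> G f bf;
  rewrite ?tens_eval_cat ?tens_reprP /tens_eval ?big_seq1 //=;
  case: bf.
Qed.

Lemma tens_lift_tens (G : zmodType) (f : M -> N -> G) m n :
  balanced f -> tens_lift f (tens m n) = f m n.
Proof. by move=> bf; rewrite /tens_lift tens_reprP // /tens_eval big_seq1. Qed.

Lemma tens_liftD (G : zmodType) (f : M -> N -> G) x y :
  balanced f -> tens_lift f (x + y) = tens_lift f x + tens_lift f y.
Proof. by move=> bf; rewrite /tens_lift tens_reprP // tens_eval_cat. Qed.

Lemma tensor_ind_sum (x : tensor) :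
  exists s : seq (M * N), x = \sum_(p <- s) tens p.1 p.2.
Proof. by exists (repr x); rewrite -pi_tensorE reprK. Qed.

End Tensor.

Section BimoduleTensor.
Context (K : fieldType) (B : algType K) (M N : bimodType B).

Definition bitensor : Type := tensor (@ract K B M) (@lact K B N).
HB.instance Definition _ := GRing.Zmodule.on bitensor.

Definition btens (m : M) (n : N) : bitensor := tens _ _ m n.

Definition bitensor_lact (a : B) : bitensor -> bitensor :=
  tens_lift (fun m n => btens (lact a m) n).
Definition bitensor_ract (x : bitensor) (a : B) : bitensor :=
  tens_lift (fun m n => btens m (ract n a)) x.

Lemma btens_balanced : balanced (@ract K B M) (@lact K B N) btens.
Proof. exact: tens_balanced. Qed.

Let bal_l a : balanced (@ract K B M) (@lact K B N)
  (fun m n => btens (lact a m) n).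
Proof.
have [Dl Dr Mm] := btens_balanced.
split=> [m m' n|m n n'|m k n]; first by rewrite lactDr Dl.
  by rewrite Dr.
by rewrite -lractA Mm.
Qed.

Let bal_r a : balanced (@ract K B M) (@lact K B N)
  (fun m n => btens m (ract n a)).
Proof.
have [Dl Dr Mm] := btens_balanced.
split=> [m m' n|m n n'|m k n]; first by rewrite Dl.
  by rewrite ractDl Dr.
by rewrite Mm lractA.
Qed.

Lemma bitensor_lact_tens a m n :
  bitensor_lact a (btens m n) = btens (lact a m) n.
Proof. exact: (tens_lift_tens _ _ (bal_l a)). Qed.

Lemma bitensor_ract_tens a m n :
  bitensor_ract (btens m n) a = btens m (ract n a).
Proof. exact: (tens_lift_tens _ _ (bal_r a)). Qed.

Lemma bitensor_lactDr a : {morph bitensor_lact a : x y / x + y}.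
Proof. by move=> x y; apply: (tens_liftD _ _ (bal_l a)). Qed.

Lemma bitensor_ractDl a : {morph bitensor_ract^~ a : x y / x + y}.
Proof. by move=> x y; apply: (tens_liftD _ _ (bal_r a)). Qed.

Lemma bitensor_ext (f g : bitensor -> bitensor) :
  {morph f : x y / x + y} -> {morph g : x y / x + y} ->
  (forall m n, f (btens m n) = g (btens m n)) -> f =1 g.
Proof.
move=> fD gD fg x; have [s ->] := tensor_ind_sum x.
have f0 : f 0 = 0 by apply: (addIr (f 0)); rewrite -fD !add0r.
have g0 : g 0 = 0 by apply: (addIr (g 0)); rewrite -gD !add0r.
by elim: s => [|p s IHs]; rewrite ?big_nil ?f0 ?g0 // big_cons fD gD IHs fg.
Qed.

Fact bitensor_lactDl x : {morph bitensor_lact^~ x : a b / a + b}.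
Proof.
move=> a b; apply: (bitensor_ext (f := bitensor_lact (a + b))
  (g := fun x => bitensor_lact a x + bitensor_lact b x)) x => [|y z|m n].
- exact: bitensor_lactDr.
- by rewrite !bitensor_lactDr addrACA.
- by rewrite !bitensor_lact_tens lactDl (balancedDl btens_balanced).
Qed.

Fact bitensor_lact1 x : bitensor_lact 1 x = x.
Proof.
apply: (bitensor_ext (g := id)) x => [||m n] //.
  exact: bitensor_lactDr.
by rewrite bitensor_lact_tens lact1.
Qed.

Fact bitensor_lactA a b x :
  bitensor_lact a (bitensor_lact b x) = bitensor_lact (a * b) x.
Proof.
apply: (bitensor_ext (f := bitensor_lact a \o bitensor_lact b)) x
  => [y z /=||m n /=]; rewrite ?bitensor_lactDr //.
  exact: bitensor_lactDr.
by rewrite !bitensor_lact_tens lactA.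
Qed.

Fact bitensor_ractDr x : {morph bitensor_ract x : a b / a + b}.
Proof.
move=> a b; apply: (bitensor_ext (f := bitensor_ract^~ (a + b))
  (g := fun x => bitensor_ract x a + bitensor_ract x b)) x => [|y z|m n].
- exact: bitensor_ractDl.
- by rewrite !bitensor_ractDl addrACA.
- by rewrite !bitensor_ract_tens ractDr (balancedDr btens_balanced).
Qed.

Fact bitensor_ract1 x : bitensor_ract x 1 = x.
Proof.
apply: (bitensor_ext (f := bitensor_ract^~ 1) (g := id)) x => [||m n] //.
  exact: bitensor_ractDl.
by rewrite bitensor_ract_tens ract1.
Qed.

Fact bitensor_ractA a b x :
  bitensor_ract (bitensor_ract x a) b = bitensor_ract x (a * b).
Proof.
apply: (bitensor_ext (f := bitensor_ract^~ b \o bitensor_ract^~ a)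
  (g := bitensor_ract^~ (a * b))) x => [y z /=||m n /=];
  rewrite ?bitensor_ractDl //.
  exact: bitensor_ractDl.
by rewrite !bitensor_ract_tens ractA.
Qed.

Fact bitensor_lractA a b x :
  bitensor_ract (bitensor_lact a x) b = bitensor_lact a (bitensor_ract x b).
Proof.
apply: (bitensor_ext (f := bitensor_ract^~ b \o bitensor_lact a)
  (g := bitensor_lact a \o bitensor_ract^~ b)) x
  => [y z /=|y z /=|m n /=]; rewrite ?(bitensor_ractDl, bitensor_lactDr) //.
by rewrite !(bitensor_ract_tens, bitensor_lact_tens).
Qed.

Fact bitensor_scalar (c : K) x : bitensor_lact c%:A x = bitensor_ract x c%:A.
Proof.
apply: (bitensor_ext (g := bitensor_ract^~ c%:A)) x => [||m n].
- exact: bitensor_lactDr.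
- exact: bitensor_ractDl.
- by rewrite bitensor_lact_tens bitensor_ract_tens lract_scalar
    (balancedM btens_balanced) lract_scalar.
Qed.

HB.instance Definition _ := Zmodule_isBimodule.Build K B bitensor
  bitensor_lactDr bitensor_lactDl bitensor_lact1 bitensor_lactA
  bitensor_ractDl bitensor_ractDr bitensor_ract1 bitensor_ractA
  bitensor_lractA bitensor_scalar.

End BimoduleTensor.

Notation "m ⊗ n" := (btens m n) (at level 35, right associativity) : ring_scope.

(* The part in degrees at most two of a differential graded algebra with [B]
   in degree zero, generated in degree zero. *)
Record calculus (K : fieldType) (B : algType K) := Calculus {
  form1 : bimodType B;
  form2 : bimodType B;
  d0 : B -> form1;
  d1 : form1 -> form2;
  wedge : form1 -> form1 -> form2;
  wedge_balanced : balanced (@ract K B form1) (@lact K B form1) wedge;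
  wedge_lact : forall a w h, wedge (lact a w) h = lact a (wedge w h);
  wedge_ract : forall w h a, wedge w (ract h a) = ract (wedge w h) a;
  d0_linear : forall (c : K) a b, d0 (c *: a + b) = lact c%:A (d0 a) + d0 b;
  d0M : forall a b, d0 (a * b) = ract (d0 a) b + lact a (d0 b);
  d1D : {morph d1 : w h / w + h};
  d1_lact : forall a w, d1 (lact a w) = wedge (d0 a) w + lact a (d1 w);
  d1_ract : forall w a, d1 (ract w a) = ract (d1 w) a - wedge w (d0 a);
  d1d0 : forall a, d1 (d0 a) = 0;
  form1_gen : forall w, exists s : seq (B * B),
    w = \sum_(p <- s) lact p.1 (d0 p.2);
  form2_gen : forall t, exists s : seq (form1 * form1),
    t = \sum_(p <- s) wedge p.1 p.2
}.

Section Modules.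
Context (K : fieldType) (B : algType K).

Definition right_linear (M N : bimodType B) (f : M -> N) : Prop :=
  {morph f : x y / x + y} /\ forall x a, f (ract x a) = ract (f x) a.

Definition left_linear (M N : bimodType B) (f : M -> N) : Prop :=
  {morph f : x y / x + y} /\ forall a x, f (lact a x) = lact a (f x).

Definition bimodule_map (M N : bimodType B) (f : M -> N) : Prop :=
  left_linear f /\ right_linear f.

Definition right_functional (M : bimodType B) (f : M -> B) : Prop :=
  {morph f : x y / x + y} /\ forall x a, f (ract x a) = f x * a.

(* [M] is a direct summand of the right module B^n. *)
Definition fg_projective (M : bimodType B) : Prop :=
  exists (n : nat) (i : M -> {ffun 'I_n -> B}) (p : {ffun 'I_n -> B} -> M),
    [/\ {morph i : x y / x + y} /\
          forall x a, i (ract x a) = [ffun j => i x j * a],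
        {morph p : u v / u + v} /\
          forall (u : {ffun 'I_n -> B}) a, p [ffun j => u j * a] = ract (p u) a
      & cancel i p].

Definition central (M : bimodType B) : {pred M} :=
  fun x => `[< forall a, lact a x = ract x a >].

Fact central_zmod_closed (M : bimodType B) : zmod_closed (@central M).
Proof.
split=> [|x y /asboolP hx /asboolP hy]; apply/asboolP=> a.
  by rewrite lact0r ract0l.
by rewrite lactDr lactNr hx hy ractDl ractNl.
Qed.
HB.instance Definition _ (M : bimodType B) :=
  GRing.isZmodClosed.Build M (@central M) (central_zmod_closed M).

Definition centre (M : bimodType B) := {x : M | x \in @central M}.
HB.instance Definition _ (M : bimodType B) := Choice.on (centre M).
HB.instance Definition _ (M : bimodType B) := SubType.on (centre M).
HB.instance Definition _ (M : bimodType B) :=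
  [SubChoice_isSubZmodule of centre M by <:].

Definition centre_alg := {a : B | `[< forall b, a * b = b * a >]}.

Fact centre_ract_subproof (M : bimodType B) (x : centre M) (a : centre_alg) :
  ract (val x) (val a) \in @central M.
Proof.
apply/asboolP=> b; have /asboolP hx := valP x; have /asboolP ha := valP a.
by rewrite -lractA hx !ractA ha.
Qed.
Definition centre_ract (M : bimodType B) (x : centre M) (a : centre_alg) :
  centre M := Sub (ract (val x) (val a)) (centre_ract_subproof x a).

(* Z(M) \otimes_{Z(B)} B \to M *)
Definition centre_mult (M : bimodType B) :
    tensor (@centre_ract M) (fun (z : centre_alg) (a : B) => val z * a) -> M :=
  tens_lift (fun x a => ract (val x) a).

End Modules.

Section TameCalculus.
Context (K : fieldType) (B : algType K) (Omega : calculus B).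
Local Notation Omega1 := (form1 Omega).
Local Notation Omega2 := (form2 Omega).
Local Notation T2 := (bitensor Omega1 Omega1).

Definition wedge_tensor : T2 -> Omega2 := tens_lift (@wedge K B Omega).

(* [P] is the idempotent P_sym of a decomposition
   Omega^1 \otimes Omega^1 = Ker(\wedge) \oplus F; F is its kernel. *)
Definition quasi_tame (P : T2 -> T2) : Prop :=
  [/\ fg_projective Omega1,
      bimodule_map P,
      forall x, P (P x) = P x,
      range P = [set x | wedge_tensor x = 0]
    & exists phi : Omega2 -> T2,
        [/\ right_linear phi, injective phi & range phi = [set x | P x = 0]]].

Definition sigma_of (P : T2 -> T2) (x : T2) : T2 := P x *+ 2 - x.

Definition tame (P : T2 -> T2) : Prop :=
  [/\ quasi_tame P,
      bijective (@centre_mult K B Omega1)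
    & forall w h : centre Omega1,
        sigma_of P (val w ⊗ val h) = val h ⊗ val w].

(* The decomposition making a tame calculus tame is unique, as the tensors of
   central forms span. *)
Definition Psym : T2 -> T2 := xget (fun=> 0) [set P | tame P].
Definition sigma : T2 -> T2 := sigma_of Psym.

Definition pseudo_riemannian (g : T2 -> B) : Prop :=
  [/\ right_functional g,
      forall x, g (sigma x) = g x,
      injective (fun w h => g (w ⊗ h))
    & forall f : Omega1 -> B, right_functional f ->
        exists w, forall h, f h = g (w ⊗ h)].

Definition connection (nabla : Omega1 -> T2) : Prop :=
  [/\ {morph nabla : w h / w + h},
      forall (c : K) w, nabla (lact c%:A w) = lact c%:A (nabla w)
    & forall w a, nabla (ract w a) = ract (nabla w) a + w ⊗ d0 Omega a].

Definition strongly_sigma_compatible (g : T2 -> B) : Prop :=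
  forall w h w' h' : centre Omega1,
    GRing.comm (g (val w ⊗ val h)) (g (val w' ⊗ val h')).

(* Omega^1 \otimes (Omega^1 \otimes Omega^1) *)
Local Notation T3 := (bitensor Omega1 T2).

Definition tensor_append (x : T2) (h : Omega1) : T3 :=
  tens_lift (fun u v => u ⊗ v ⊗ h) x.
Definition sigma23 : T3 -> T3 := tens_lift (fun u x => u ⊗ sigma x).
Definition metric_id (g : T2 -> B) : T3 -> Omega1 :=
  tens_lift (fun u => tens_lift (fun v w => lact (g (u ⊗ v)) w)).

(* The value of Pi_g(nabla) at w \otimes h a, for central forms w and h. *)
Definition Pi_metric (g : T2 -> B) (nabla : Omega1 -> T2) (w h : Omega1)
    (a : B) : Omega1 :=
  ract (metric_id g
    (sigma23 (tensor_append (nabla w) h + tensor_append (nabla h) w))) a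
  + lact (g (w ⊗ h)) (d0 Omega a).

Definition torsion_free (nabla : Omega1 -> T2) : Prop :=
  forall w, wedge_tensor (nabla w) + d1 w = 0.

(* Pi_g(nabla) = d \circ g: the elements w \otimes h a with w and h central
   span Omega^1 \otimes Omega^1. *)
Definition metric_compatible (g : T2 -> B) (nabla : Omega1 -> T2) : Prop :=
  forall (w h : centre Omega1) (a : B),
    Pi_metric g nabla (val w) (val h) a =
    d0 Omega (g (val w ⊗ ract (val h) a)).

Definition is_levi_civita (g : T2 -> B) (nabla : Omega1 -> T2) : Prop :=
  [/\ connection nabla, torsion_free nabla & metric_compatible g nabla].

Definition levi_civita (g : T2 -> B) : Omega1 -> T2 :=
  xget (fun=> 0) [set nabla | is_levi_civita g nabla].

End TameCalculus.

(* An algebra [B] of operators on the domain [dm_space] of an operator [dirac]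
   that is invariant under [B] and under [dirac]. *)
Record dirac_module (K : fieldType) (B : algType K) := DiracModule {
  dm_space : lmodType K;
  dm_act : B -> {linear dm_space -> dm_space};
  dirac : {linear dm_space -> dm_space};
  dm_actD : forall a b v, dm_act (a + b) v = dm_act a v + dm_act b v;
  dm_actZ : forall c a v, dm_act (c *: a) v = c *: dm_act a v;
  dm_act1 : forall v, dm_act 1 v = v;
  dm_actM : forall a b v, dm_act (a * b) v = dm_act a (dm_act b v)
}.

Section Connes.
Context (K : fieldType) (B : algType K) (X : dirac_module B).
Local Notation V := (dm_space X).
Local Notation act := (dm_act X).
Local Notation D := (dirac X).
Implicit Types (a b : B) (v : V).

Definition comm a : V -> V := fun v => D (act a v) - act a (D v).

(* Representatives \sum a_0 \delta a_1 ... \delta a_k of the elements of the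
   reduced universal differential graded algebra in degree [k].  Every element
   has one, and [Pi_rep] and [Pi_rep \o delta_rep] depend only on the element
   represented, being additive in each a_i and zero when one of
   a_1, ..., a_k is a scalar. *)
Definition urep (k : nat) := seq (B * k.-tuple B).

Definition comm_prod (s : seq B) : V -> V :=
  foldr (fun a (f : V -> V) => comm a \o f) id s.

Definition Pi_rep k (w : urep k) : V -> V :=
  \sum_(p <- w) (act p.1 \o comm_prod p.2).

Definition delta_rep k (w : urep k) : urep k.+1 :=
  [seq (1, cons_tuple p.1 p.2) | p <- w].

Let act0 v : act 0 v = 0.
Proof. by apply: (addIr (act 0 v)); rewrite -dm_actD !add0r. Qed.
Let actN a v : act (- a) v = - act a v.
Proof. by apply: (addIr (act a v)); rewrite -dm_actD !addNr act0. Qed.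

Lemma commD a b v : comm (a + b) v = comm a v + comm b v.
Proof. by rewrite /comm !dm_actD linearD opprD addrACA. Qed.

Lemma commN a v : comm (- a) v = - comm a v.
Proof. by rewrite /comm !actN linearN -opprD. Qed.

Lemma comm_linD a u v : comm a (u + v) = comm a u + comm a v.
Proof. by rewrite /comm !linearD ?opprD addrACA. Qed.

Lemma comm0r a : comm a 0 = 0.
Proof. by rewrite /comm !linear0 ?subr0 ?addr0. Qed.

Lemma commM a b v : comm (a * b) v = comm a (act b v) + act a (comm b v).
Proof. by rewrite /comm !dm_actM linearB addrA subrK. Qed.

Lemma comm1 v : comm 1 v = 0.
Proof. by rewrite /comm !dm_act1 subrr. Qed.

Lemma commZ c a v : comm (c *: a) v = c *: comm a v.
Proof. by rewrite /comm !dm_actZ linearZ /= scalerBr. Qed.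

Lemma comm_prod0r s : comm_prod s 0 = 0.
Proof. by elim: s => //= a s IHs; rewrite IHs comm0r. Qed.

Lemma comm_prodN s v : comm_prod s (- v) = - comm_prod s v.
Proof.
elim: s => //= a s IHs; rewrite IHs.
by apply: (addIr (comm a (comm_prod s v))); rewrite -comm_linD !addNr comm0r.
Qed.

Lemma comm_prodD s u v : comm_prod s (u + v) = comm_prod s u + comm_prod s v.
Proof. by elim: s => //= a s IHs; rewrite IHs comm_linD. Qed.

Lemma comm_prod_rcons s b v : comm_prod (rcons s b) v = comm_prod s (comm b v).
Proof. by elim: s => //= a s ->. Qed.

Lemma Pi_repE k (w : urep k) v :
  Pi_rep w v = \sum_(p <- w) act p.1 (comm_prod p.2 v).
Proof. by rewrite /Pi_rep; elim/big_rec2: _ => // p y f _ <-. Qed.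

Lemma Pi_deltaE k (w : urep k) v :
  Pi_rep (delta_rep w) v = \sum_(p <- w) comm p.1 (comm_prod p.2 v).
Proof.
by rewrite Pi_repE big_map; apply: eq_bigr => p _ /=; rewrite dm_act1.
Qed.

Lemma Pi_repD k (w : urep k) u v :
  Pi_rep w (u + v) = Pi_rep w u + Pi_rep w v.
Proof.
rewrite !Pi_repE -big_split; apply: eq_bigr => p _ /=.
by rewrite comm_prodD linearD.
Qed.

Lemma Pi_rep_cat k (w w' : urep k) v :
  Pi_rep (w ++ w') v = Pi_rep w v + Pi_rep w' v.
Proof. by rewrite !Pi_repE big_cat. Qed.

Definition neg_rep k (w : urep k) : urep k := [seq (- p.1, p.2) | p <- w].

Lemma Pi_neg k (w : urep k) v : Pi_rep (neg_rep w) v = - Pi_rep w v.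
Proof.
by rewrite !Pi_repE big_map -sumrN; apply: eq_bigr => p _; rewrite actN.
Qed.

Lemma Pi_delta_neg k (w : urep k) v :
  Pi_rep (delta_rep (neg_rep w)) v = - Pi_rep (delta_rep w) v.
Proof.
by rewrite !Pi_deltaE big_map -sumrN; apply: eq_bigr => p _; rewrite commN.
Qed.

Lemma delta_rep_cat k (w w' : urep k) :
  delta_rep (w ++ w') = delta_rep w ++ delta_rep w'.
Proof. exact: map_cat. Qed.

Lemma Pi_delta_delta k (w : urep k) v : Pi_rep (delta_rep (delta_rep w)) v = 0.
Proof.
by rewrite Pi_deltaE big_map big1 // => p _ /=; rewrite comm1.
Qed.

Definition lmul_rep k a (w : urep k) : urep k := [seq (a * p.1, p.2) | p <- w].

Lemma Pi_lmul k a (w : urep k) v : Pi_rep (lmul_rep a w) v = act a (Pi_rep w v).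
Proof.
rewrite !Pi_repE big_map linear_sum; apply: eq_bigr => p _ /=.
by rewrite dm_actM.
Qed.

Lemma Pi_delta_lmul k a (w : urep k) v :
  Pi_rep (delta_rep (lmul_rep a w)) v =
  comm a (Pi_rep w v) + act a (Pi_rep (delta_rep w) v).
Proof.
rewrite !(Pi_repE, Pi_deltaE) !big_map linear_sum /=.
rewrite (big_morph _ (comm_linD a) (comm0r a)) -big_split /=.
by apply: eq_bigr => p _ /=; rewrite !dm_act1 commM.
Qed.

(* (a_0 \delta a_1 ... \delta a_k) b, expanded by the Leibniz rule. *)
Lemma rmul_word k a (s : k.-tuple B) b : exists w : urep k,
  (forall v, Pi_rep w v = act a (comm_prod s (act b v))) /\
  (forall v, Pi_rep (delta_rep w) v =
     comm a (comm_prod s (act b v)) +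
     (-1) ^+ k *: act a (comm_prod s (comm b v))).
Proof.
elim: k a s => [|k IHk] a s.
  exists [:: (a * b, [tuple])]; split=> v; rewrite (tuple0 s).
    by rewrite Pi_repE big_seq1 /= dm_actM.
  by rewrite Pi_deltaE big_seq1 /= commM scale1r.
case: (tupleP s) => a1 s'; have [w [wP wd]] := IHk a1 s'.
pose c : B := - ((-1) ^+ k *: (a * a1)).
exists ([seq (a, cons_tuple p.1 p.2) | p <- w]
        ++ [:: (c, rcons_tuple s' b)]); split=> v.
  rewrite Pi_rep_cat Pi_repE big_map /= -linear_sum -Pi_deltaE wd.
  rewrite Pi_repE big_seq1 /= comm_prod_rcons linearD -addrA.
  rewrite actN dm_actZ dm_actM linearZ /= addrN addr0.
  by [].
rewrite delta_rep_cat Pi_rep_cat !Pi_deltaE big_map big_seq1 /=.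
rewrite -(big_morph _ (comm_linD a) (comm0r a)) -Pi_deltaE wd.
rewrite comm_prod_rcons commN commZ commM comm_linD.
have -> : comm a ((-1) ^+ k *: act a1 (comm_prod s' (comm b v)))
  = (-1) ^+ k *: comm a (act a1 (comm_prod s' (comm b v))).
  by rewrite /comm !linearZ /= ?scalerBr ?scalerN.
rewrite -addrA; congr (_ + _); rewrite -scalerBr opprD addrA subrr add0r.
by rewrite scalerN exprS mulN1r scaleNr.
Qed.

Lemma rmul_rep k (w : urep k) b : exists w' : urep k,
  (forall v, Pi_rep w' v = Pi_rep w (act b v)) /\
  (forall v, Pi_rep (delta_rep w') v =
     Pi_rep (delta_rep w) (act b v) + (-1) ^+ k *: Pi_rep w (comm b v)).
Proof.
elim: w => [|[a s] w [w' [h1 h2]]].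
  by exists [::]; split=> v; rewrite !Pi_repE !big_nil // scaler0 addr0.
have [u [u1 u2]] := rmul_word a s b.
exists (u ++ w'); split=> v.
  by rewrite Pi_rep_cat u1 h1 [RHS]Pi_repE big_cons -Pi_repE.
rewrite delta_rep_cat Pi_rep_cat u2 h2 [in RHS]Pi_deltaE [in RHS]Pi_repE !big_cons /=.
by rewrite -Pi_deltaE -Pi_repE scalerDr addrACA.
Qed.

(* w \delta b *)
Definition append_rep k (w : urep k) b : urep k.+1 :=
  [seq (p.1, rcons_tuple p.2 b) | p <- w].

Lemma Pi_append k (w : urep k) b v :
  Pi_rep (append_rep w b) v = Pi_rep w (comm b v).
Proof.
by rewrite !Pi_repE big_map; apply: eq_bigr => p _ /=; rewrite comm_prod_rcons.
Qed.

Lemma Pi_delta_append k (w : urep k) b v :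
  Pi_rep (delta_rep (append_rep w b)) v = Pi_rep (delta_rep w) (comm b v).
Proof.
rewrite !Pi_deltaE big_map; apply: eq_bigr => p _ /=.
by rewrite comm_prod_rcons.
Qed.

(* \Pi(\Omega_u^k) *)
Definition forms k : {pred V -> V} := fun T => `[< exists w : urep k, T = Pi_rep w >].

(* \Pi(\delta J_0^{k-1}) *)
Definition junk_op k (T : V -> V) : Prop :=
  if k is j.+1
  then exists w : urep j, Pi_rep w = 0 /\ T = Pi_rep (delta_rep w)
  else T = 0.

Fact forms_zmod_closed k : zmod_closed (forms k).
Proof.
split=> [|x y /asboolP[w ->] /asboolP[w' ->]]; apply/asboolP.
  by exists [::]; rewrite /Pi_rep big_nil.
by exists (w ++ neg_rep w'); apply/funext=> v; rewrite Pi_rep_cat Pi_neg.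
Qed.
HB.instance Definition _ k :=
  GRing.isZmodClosed.Build (V -> V) (forms k) (forms_zmod_closed k).

Definition form_op k := {T : V -> V | T \in forms k}.
HB.instance Definition _ k := Choice.on (form_op k).
HB.instance Definition _ k := SubType.on (form_op k).
HB.instance Definition _ k := [SubChoice_isSubZmodule of form_op k by <:].

Definition junk k : {pred form_op k} := fun T => `[< junk_op k (val T) >].

Lemma junk_op_closed k : junk_op k 0 /\
  forall S T, junk_op k S -> junk_op k T -> junk_op k (S - T).
Proof.
case: k => [|k] /=.
  by split=> // S T -> ->; rewrite subr0.
split.
  by exists [::]; rewrite /Pi_rep !big_nil.
move=> S T [w [w0 ->]] [w' [w'0 ->]]; exists (w ++ neg_rep w').
split; apply/funext=> v.
  by rewrite Pi_rep_cat Pi_neg w0 w'0 subrr.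
by rewrite delta_rep_cat Pi_rep_cat Pi_delta_neg.
Qed.

Fact junk_zmod_closed k : zmod_closed (@junk k).
Proof.
have [j0 jB] := junk_op_closed k.
split=> [|S T /asboolP hS /asboolP hT]; apply/asboolP; first by rewrite raddf0.
by rewrite raddfB; apply: jB.
Qed.
HB.instance Definition _ k :=
  GRing.isZmodClosed.Build (form_op k) (@junk k) (@junk_zmod_closed k).

(* Connes' k-forms, \Pi(\Omega_u^k) / \Pi(\delta J_0^{k-1}) *)
Definition cform k : Type := @Quotient.quot (form_op k) (@junk k).
HB.instance Definition _ k := Choice.on (cform k).
HB.instance Definition _ k := GRing.Zmodule.on (cform k).

Definition form_class k (T : form_op k) : cform k :=
  \pi_(@Quotient.quot (form_op k) (@junk k)) T.
Definition form_repr k (x : cform k) : form_op k := repr x.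

Lemma form_reprK k (x : cform k) : form_class (form_repr x) = x.
Proof. exact: reprK. Qed.

Lemma form_classP k (S T : form_op k) :
  form_class S = form_class T <-> junk_op k (val S - val T).
Proof.
rewrite -raddfB; split=> [/eqP|h].
  by rewrite -Quotient.idealrBE => /asboolP.
by apply/eqP; rewrite -Quotient.idealrBE; apply/asboolP.
Qed.

Lemma form_classD k (S T : form_op k) :
  form_class (S + T) = form_class S + form_class T.
Proof. exact: (raddfD \pi_(@Quotient.quot (form_op k) (@junk k))). Qed.

Lemma form_class_ind k (P : cform k -> Prop) :
  (forall T, P (form_class T)) -> forall x, P x.
Proof. by move=> h x; rewrite -(form_reprK x). Qed.

Lemma junk_op_repr k (T : form_op k) :
  junk_op k (val (form_repr (form_class T)) - val T).
Proof. by apply/form_classP; rewrite form_reprK. Qed.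

Lemma formsP k (T : form_op k) : exists w : urep k, val T = Pi_rep w.
Proof. exact/asboolP/(valP T). Qed.

Lemma form_opD k (T : form_op k) u v : val T (u + v) = val T u + val T v.
Proof. by have [w ->] := formsP T; rewrite Pi_repD. Qed.

Fact forms_lmul k a (T : form_op k) : act a \o val T \in forms k.
Proof.
have [w ->] := formsP T; apply/asboolP; exists (lmul_rep a w).
by apply/funext=> v; rewrite Pi_lmul.
Qed.

Fact forms_rmul k (T : form_op k) b : val T \o act b \in forms k.
Proof.
have [w ->] := formsP T; have [w' [w'P _]] := rmul_rep w b.
by apply/asboolP; exists w'; apply/funext=> v; rewrite w'P.
Qed.

Definition form_lmul k a (T : form_op k) : form_op k := Sub (act a \o val T) (forms_lmul a T).
Definition form_rmul k (T : form_op k) b : form_op k := Sub (val T \o act b) (forms_rmul T b).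

Lemma junk_lmul k a (T : V -> V) : junk_op k T -> junk_op k (act a \o T).
Proof.
case: k => [|k] /= => [->|[w [w0 ->]]].
  by apply/funext=> v /=; rewrite linear0.
exists (lmul_rep a w); split; apply/funext=> v.
  by rewrite Pi_lmul w0 linear0.
by rewrite Pi_delta_lmul w0 comm0r add0r.
Qed.

Lemma junk_rmul k (T : V -> V) b : junk_op k T -> junk_op k (T \o act b).
Proof.
case: k => [|k] /= => [->|[w [w0 ->]]]; first exact/funext.
have [w' [w'P w'd]] := rmul_rep w b; exists w'; split; apply/funext=> v.
  by rewrite w'P w0.
by rewrite w'd w0 scaler0 addr0.
Qed.

Definition cform_lact k a (x : cform k) : cform k :=
  form_class (form_lmul a (form_repr x)).
Definition cform_ract k (x : cform k) a : cform k :=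
  form_class (form_rmul (form_repr x) a).

Lemma cform_lactE k a (T : form_op k) :
  cform_lact a (form_class T) = form_class (form_lmul a T).
Proof.
apply/form_classP; rewrite !SubK.
rewrite (_ : _ - _ =
  act a \o (val (form_repr (form_class T)) - val T)); last first.
  by apply/funext=> v /=; rewrite linearB.
exact/junk_lmul/junk_op_repr.
Qed.

Lemma cform_ractE k a (T : form_op k) :
  cform_ract (form_class T) a = form_class (form_rmul T a).
Proof.
apply/form_classP; rewrite !SubK.
rewrite (_ : _ - _ =
  (val (form_repr (form_class T)) - val T) \o act a) //.
exact/junk_rmul/junk_op_repr.
Qed.

Lemma form_class_eq k (S T : form_op k) :
  (forall v, val S v = val T v) -> form_class S = form_class T.
Proof. by move=> h; congr form_class; apply/val_inj/funext. Qed.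

Fact cform_lactDr k a : {morph @cform_lact k a : x y / x + y}.
Proof.
elim/form_class_ind => S; elim/form_class_ind => T.
rewrite -form_classD !cform_lactE -form_classD; apply: form_class_eq => v /=.
by rewrite linearD.
Qed.
Fact cform_lactDl k (x : cform k) : {morph (@cform_lact k)^~ x : a b / a + b}.
Proof.
move=> a b; elim/form_class_ind: x => T.
rewrite !cform_lactE -form_classD; apply: form_class_eq => v /=.
by rewrite dm_actD.
Qed.
Fact cform_lact1 k (x : cform k) : cform_lact 1 x = x.
Proof.
elim/form_class_ind: x => T; rewrite cform_lactE.
by apply: form_class_eq => v /=; rewrite dm_act1.
Qed.
Fact cform_lactA k a b (x : cform k) :
  cform_lact a (cform_lact b x) = cform_lact (a * b) x.
Proof.
elim/form_class_ind: x => T; rewrite !cform_lactE.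
by apply: form_class_eq => v /=; rewrite dm_actM.
Qed.
Fact cform_ractDl k a : {morph (@cform_ract k)^~ a : x y / x + y}.
Proof.
elim/form_class_ind => S; elim/form_class_ind => T.
by rewrite -form_classD !cform_ractE -form_classD; apply: form_class_eq.
Qed.
Fact cform_ractDr k (x : cform k) : {morph @cform_ract k x : a b / a + b}.
Proof.
move=> a b; elim/form_class_ind: x => T.
rewrite !cform_ractE -form_classD; apply: form_class_eq => v /=.
by rewrite dm_actD form_opD.
Qed.
Fact cform_ract1 k (x : cform k) : cform_ract x 1 = x.
Proof.
elim/form_class_ind: x => T; rewrite cform_ractE.
by apply: form_class_eq => v /=; rewrite dm_act1.
Qed.
Fact cform_ractA k a b (x : cform k) :
  cform_ract (cform_ract x a) b = cform_ract x (a * b).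
Proof.
elim/form_class_ind: x => T; rewrite !cform_ractE.
by apply: form_class_eq => v /=; rewrite dm_actM.
Qed.
Fact cform_lractA k a b (x : cform k) :
  cform_ract (cform_lact a x) b = cform_lact a (cform_ract x b).
Proof.
elim/form_class_ind: x => T; rewrite !(cform_ractE, cform_lactE).
exact: form_class_eq.
Qed.

Let comm_prodZ c s v : comm_prod s (c *: v) = c *: comm_prod s v.
Proof.
elim: s => //= a s ->; rewrite /comm.
by rewrite !linearZ /= ?scalerBr ?scalerN.
Qed.

Lemma form_opZ k (T : form_op k) c v : val T (c *: v) = c *: val T v.
Proof.
have [w ->] := formsP T; rewrite !Pi_repE scaler_sumr.
by apply: eq_bigr => p _; rewrite comm_prodZ linearZ.
Qed.

Fact cform_scalar k (c : K) (x : cform k) :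
  cform_lact c%:A x = cform_ract x c%:A.
Proof.
elim/form_class_ind: x => T; rewrite cform_ractE cform_lactE.
by apply: form_class_eq => v /=; rewrite !dm_actZ !dm_act1 form_opZ.
Qed.

HB.instance Definition _ k := Zmodule_isBimodule.Build K B (cform k)
  (@cform_lactDr k) (@cform_lactDl k) (@cform_lact1 k) (@cform_lactA k)
  (@cform_ractDl k) (@cform_ractDr k) (@cform_ract1 k) (@cform_ractA k)
  (@cform_lractA k) (@cform_scalar k).

Fact forms_mul k (S : form_op k) (T : form_op 1) : val S \o val T \in forms k.+1.
Proof.
have [w wP] := formsP S; have [u uP] := formsP T.
suff [w' w'P] : exists w' : urep k.+1,
    forall v, Pi_rep w' v = Pi_rep w (Pi_rep u v).
  by apply/asboolP; exists w'; apply/funext=> v /=; rewrite wP uP w'P.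
elim: {T uP} u => [|[a s] u [w' w'P]].
  exists [::] => v; rewrite !Pi_repE !big_nil big1 // => p _.
  by rewrite comm_prod0r linear0.
have [w1 [w1P _]] := rmul_rep w a.
exists (append_rep w1 (thead s) ++ w') => v.
rewrite Pi_rep_cat w'P Pi_append w1P [Pi_rep (_ :: u) v]Pi_repE big_cons.
rewrite -Pi_repE Pi_repD; congr (Pi_rep w (act a _) + _).
by case: (tupleP s) => b s'; rewrite (tuple0 s') theadE.
Qed.
Definition form_mul k (S : form_op k) (T : form_op 1) : form_op k.+1 :=
  Sub (val S \o val T) (forms_mul S T).

Lemma junk1 (T : V -> V) : junk_op 1 T -> T = 0.
Proof.
case=> w [w0 ->]; apply/funext=> v; rewrite Pi_deltaE.
have h u : \sum_(p <- w) act p.1 u = 0.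
  rewrite -[RHS]/((0 : V -> V) u) -w0 Pi_repE.
  by apply: eq_bigr => -[a s] _; rewrite (tuple0 s).
rewrite (eq_bigr (fun p => D (act p.1 v) - act p.1 (D v))); last first.
  by move=> [a s] _; rewrite (tuple0 s).
by rewrite big_split /= sumrN h -linear_sum h linear0 subr0.
Qed.

Lemma junk_mul k (S : V -> V) (T : form_op 1) :
  junk_op k S -> junk_op k.+1 (S \o val T).
Proof.
have [u ->] := formsP T; case: k => [->|k [w [w0 ->]]].
  exists [::]; split; first by rewrite /Pi_rep big_nil.
  by rewrite /Pi_rep big_nil; apply/funext.
elim: u => [|[a s] u [w' [w'0 w'P]]].
  exists [::]; split; first by rewrite /Pi_rep big_nil.
  apply/funext=> v /=; rewrite [Pi_rep [::] v]Pi_repE big_nil.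
  by rewrite Pi_repE big1 ?Pi_repE ?big_nil // => p _; rewrite comm_prod0r linear0.
have [w1 [w1P w1d]] := rmul_rep w a.
exists (append_rep w1 (thead s) ++ w'); split; apply/funext=> v.
  by rewrite Pi_rep_cat w'0 Pi_append w1P w0 addr0.
rewrite delta_rep_cat Pi_rep_cat Pi_delta_append w1d w0 scaler0 addr0.
rewrite -w'P /= [Pi_rep (_ :: u) v]Pi_repE big_cons -Pi_repE Pi_repD.
congr (Pi_rep (delta_rep w) (act a _) + _).
by case: (tupleP s) => b s'; rewrite (tuple0 s') theadE.
Qed.

Definition cform_wedge k (x : cform k) (y : cform 1) : cform k.+1 :=
  form_class (form_mul (form_repr x) (form_repr y)).

Lemma cform_wedgeE k (S : form_op k) (T : form_op 1) :
  cform_wedge (form_class S) (form_class T) = form_class (form_mul S T).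
Proof.
apply/form_classP; rewrite !SubK.
have -> : val (form_repr (form_class T)) = val T.
  by apply/eqP; rewrite -subr_eq0; apply/eqP/junk1/junk_op_repr.
rewrite (_ : _ - _ =
  (val (form_repr (form_class S)) - val S) \o val T) //.
exact/junk_mul/junk_op_repr.
Qed.

Fact forms_diff k (w : urep k) : Pi_rep (delta_rep w) \in forms k.+1.
Proof. by apply/asboolP; exists (delta_rep w). Qed.
Definition form_delta k (w : urep k) : form_op k.+1 := Sub (Pi_rep (delta_rep w)) (forms_diff w).

Definition form_word k (T : form_op k) : urep k := sval (cid (formsP T)).
Lemma form_wordP k (T : form_op k) : val T = Pi_rep (form_word T).
Proof. exact: svalP (cid (formsP T)). Qed.

(* d[\Pi(w)] = [\Pi(\delta w)] *)
Definition cform_d k (x : cform k) : cform k.+1 :=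
  form_class (form_delta (form_word (form_repr x))).

Lemma cform_dE k (T : form_op k) (w : urep k) :
  val T = Pi_rep w -> cform_d (form_class T) = form_class (form_delta w).
Proof.
move=> TE; apply/form_classP; rewrite !SubK /=.
have := junk_op_repr T; rewrite form_wordP TE; move: (form_word _) => w1.
case: k T w w1 {TE} => [|k] T w w1 /= => [h|[u [u0 h]]].
  exists (w1 ++ neg_rep w); split; apply/funext=> v.
    by rewrite Pi_rep_cat Pi_neg; apply: (congr1 (@^~ v) h).
  by rewrite delta_rep_cat Pi_rep_cat Pi_delta_neg.
exists ((w1 ++ neg_rep w) ++ neg_rep (delta_rep u)); split; apply/funext=> v.
  rewrite !Pi_rep_cat !Pi_neg.
  by apply/eqP; rewrite subr_eq0; apply/eqP; apply: (congr1 (@^~ v) h).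
rewrite !delta_rep_cat !Pi_rep_cat !Pi_delta_neg Pi_delta_delta oppr0 addr0.
by [].
Qed.

Fact forms_comm a : comm a \in forms 1.
Proof.
apply/asboolP; exists [:: (1, [tuple a])]; apply/funext=> v.
by rewrite Pi_repE big_seq1 /= dm_act1.
Qed.
Definition form_comm a : form_op 1 := Sub (comm a) (forms_comm a).

Definition cform_d0 a : cform 1 := form_class (form_comm a).

Fact cform_wedge_balanced :
  balanced (@ract K B (cform 1)) (@lact K B (cform 1)) (@cform_wedge 1).
Proof.
split=> [x x' y|x y y'|x a y].
- elim/form_class_ind: x => S; elim/form_class_ind: x' => S'.
  elim/form_class_ind: y => T; rewrite -form_classD !cform_wedgeE -form_classD.
  exact: form_class_eq.
- elim/form_class_ind: x => S; elim/form_class_ind: y => T.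
  elim/form_class_ind: y' => T'; rewrite -form_classD !cform_wedgeE -form_classD.
  by apply: form_class_eq => v /=; rewrite form_opD.
elim/form_class_ind: x => S; elim/form_class_ind: y => T.
rewrite [ract _ _]cform_ractE [lact _ _]cform_lactE !cform_wedgeE.
exact: form_class_eq.
Qed.

Fact cform_wedge_lact a (x y : cform 1) :
  cform_wedge (lact a x) y = lact a (cform_wedge x y).
Proof.
elim/form_class_ind: x => S; elim/form_class_ind: y => T.
rewrite [lact a (form_class S)]cform_lactE !cform_wedgeE [RHS]cform_lactE.
exact: form_class_eq.
Qed.

Fact cform_wedge_ract (x y : cform 1) a :
  cform_wedge x (ract y a) = ract (cform_wedge x y) a.
Proof.
elim/form_class_ind: x => S; elim/form_class_ind: y => T.
rewrite [ract (form_class T) a]cform_ractE !cform_wedgeE [RHS]cform_ractE.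
exact: form_class_eq.
Qed.

Fact cform_d0_linear c a b :
  cform_d0 (c *: a + b) = lact c%:A (cform_d0 a) + cform_d0 b.
Proof.
rewrite [lact _ _]cform_lactE -form_classD; apply: form_class_eq => v /=.
by rewrite commD commZ /GRing.add /= dm_actZ dm_act1.
Qed.

Fact cform_d0M a b :
  cform_d0 (a * b) = ract (cform_d0 a) b + lact a (cform_d0 b).
Proof.
rewrite [lact _ _]cform_lactE [ract _ _]cform_ractE -form_classD.
by apply: form_class_eq => v /=; rewrite commM.
Qed.

Fact cform_d1D : {morph @cform_d 1 : x y / x + y}.
Proof.
elim/form_class_ind => S; elim/form_class_ind => T.
rewrite -form_classD (cform_dE (form_wordP S)) (cform_dE (form_wordP T)).
rewrite (@cform_dE _ _ (form_word S ++ form_word T)); last first.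
  rewrite raddfD /= !form_wordP; apply/funext=> v.
  by rewrite Pi_rep_cat.
rewrite -form_classD; apply: form_class_eq => v /=.
by rewrite delta_rep_cat Pi_rep_cat.
Qed.

Fact cform_d1_lact a (x : cform 1) :
  cform_d (lact a x) = cform_wedge (cform_d0 a) x + lact a (cform_d x).
Proof.
elim/form_class_ind: x => T; rewrite [lact a (form_class T)]cform_lactE.
rewrite (cform_dE (form_wordP T)) [lact _ _]cform_lactE cform_wedgeE.
rewrite (@cform_dE _ _ (lmul_rep a (form_word T))); last first.
  by apply/funext=> v; rewrite Pi_lmul -form_wordP.
rewrite -form_classD; apply: form_class_eq => v /=.
by rewrite Pi_delta_lmul -form_wordP.
Qed.

Fact cform_d1_ract (x : cform 1) a :
  cform_d (ract x a) = ract (cform_d x) a - cform_wedge x (cform_d0 a).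
Proof.
apply/eqP; rewrite eq_sym subr_eq eq_sym; apply/eqP.
elim/form_class_ind: x => T; rewrite [ract (form_class T) a]cform_ractE.
rewrite (cform_dE (form_wordP T)) [ract _ _]cform_ractE cform_wedgeE.
have [w [wP wd]] := rmul_rep (form_word T) a.
rewrite (@cform_dE _ _ w); last first.
  by apply/funext=> v; rewrite wP -form_wordP.
rewrite -form_classD; apply: form_class_eq => v /=.
by rewrite {1}/GRing.add /= wd -form_wordP expr1 scaleN1r subrK.
Qed.

Fact cform_d1d0 a : cform_d (cform_d0 a) = 0.
Proof.
rewrite (@cform_dE _ _ [:: (1, [tuple a])]).
  have -> : (0 : cform 2) = form_class 0 by rewrite /form_class raddf0.
  apply: form_class_eq => v /=.
  by rewrite Pi_repE big_seq1 /= dm_act1 comm1.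
by apply/funext=> v; rewrite Pi_repE big_seq1 /= dm_act1.
Qed.

Fact cform1_gen (x : cform 1) : exists s : seq (B * B),
  x = \sum_(p <- s) lact p.1 (cform_d0 p.2).
Proof.
elim/form_class_ind: x => T; have [w wP] := formsP T.
exists [seq (p.1, thead p.2) | p <- w]; rewrite big_map.
pose F (p : B * 1.-tuple B) := form_lmul p.1 (form_comm (thead p.2)).
rewrite (eq_bigr (fun p => form_class (F p))); last first.
  by move=> p _; rewrite [lact _ _]cform_lactE.
rewrite -(big_morph _ (@form_classD 1) (_ : form_class 0 = 0)); last first.
  by rewrite /form_class raddf0.
apply: form_class_eq => v; rewrite wP raddf_sum /=.
rewrite /Pi_rep; congr (_ v); apply: eq_bigr => -[a s] _ /=.
by case: (tupleP s) => b s'; rewrite (tuple0 s') theadE.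
Qed.

Fact cform2_gen (x : cform 2) : exists s : seq (cform 1 * cform 1),
  x = \sum_(p <- s) cform_wedge p.1 p.2.
Proof.
elim/form_class_ind: x => T; have [w wP] := formsP T.
pose b1 (p : B * 2.-tuple B) := tnth p.2 ord0.
pose b2 (p : B * 2.-tuple B) := tnth p.2 ord_max.
pose G p := form_lmul p.1 (form_comm (b1 p)).
exists [seq (form_class (G p), cform_d0 (b2 p)) | p <- w]; rewrite big_map /=.
rewrite (eq_bigr (fun p => form_class (form_mul (G p) (form_comm (b2 p)))));
  last by move=> p _; rewrite cform_wedgeE.
rewrite -(big_morph _ (@form_classD 2) (_ : form_class 0 = 0)); last first.
  by rewrite /form_class raddf0.
apply: form_class_eq => v; rewrite wP raddf_sum /=.
rewrite /Pi_rep; congr (_ v); apply: eq_bigr => -[a s] _ /=.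
rewrite /b1 /b2 /=; case: (tupleP s) => c s'; case: (tupleP s') => c' s''.
by rewrite (tuple0 s'') /tnth /=.
Qed.

Definition connes_calculus : calculus B :=
  Calculus cform_wedge_balanced cform_wedge_lact cform_wedge_ract
    cform_d0_linear cform_d0M cform_d1D cform_d1_lact cform_d1_ract
    cform_d1d0 cform1_gen cform2_gen.

(* The class of an operator of \Pi(\Omega_u^k); operators outside
   \Pi(\Omega_u^k) are sent to 0. *)
Definition op_class k (T : V -> V) : cform k := form_class (insubd 0 T).

End Connes.

(* The norm has values in R[i], as the library's norms over R[i] do. *)
HB.mixin Record isCStar (R : realType) A of GRing.Algebra R[i] A := {
  star : A -> A;
  cnorm : A -> R[i];
  starK : involutive star;
  starD : {morph star : x y / x + y};
  starZ : forall (c : R[i]) x, star (c *: x) = Num.conj c *: star x;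
  starM : forall x y, star (x * y) = star y * star x;
  cnorm0_eq0 : forall x, cnorm x = 0 -> x = 0;
  cnormD : forall x y, cnorm (x + y) <= cnorm x + cnorm y;
  cnormZ : forall (c : R[i]) x, cnorm (c *: x) = `|c| * cnorm x;
  cnormM : forall x y, cnorm (x * y) <= cnorm x * cnorm y;
  cnorm_star : forall x, cnorm (star x * x) = cnorm x ^+ 2;
  cnorm_complete : forall u : nat -> A,
    (forall e : R[i], 0 < e -> exists N, forall m n,
        (N <= m)%N -> (N <= n)%N -> cnorm (u m - u n) < e) ->
    exists l, forall e : R[i], 0 < e -> exists N, forall n,
        (N <= n)%N -> cnorm (u n - l) < e
}.

#[short(type="cstarAlgType")]
HB.structure Definition CStar (R : realType) :=
  { A of isCStar R A & GRing.Algebra R[i] A }.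

Section CStarTheory.
Context (R : realType) (A : cstarAlgType R).

Definition is_isometry (x : A) : Prop := star x * x = 1.

Definition cdense (P : A -> Prop) : Prop :=
  forall (x : A) (e : R[i]), 0 < e -> exists2 y, P y & cnorm (x - y) < e.

Definition is_state (f : {scalar A}) : Prop :=
  [/\ forall x, 0 <= f (star x * x), forall x, `|f x| <= cnorm x & f 1 = 1].

Definition tracial (f : {scalar A}) : Prop := forall x y, f (x * y) = f (y * x).

Record faithful_state := FaithfulState {
  fstate :> {scalar A};
  fstate_state : is_state fstate;
  fstate_faithful : forall x, fstate (star x * x) = 0 -> x = 0
}.

(* The unital *-algebra generated by S_1 and S_2; the unit is S_1^* S_1 as
   soon as S_1 is an isometry. *)
Inductive star_gen (S : 'I_2 -> A) : A -> Prop :=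
| SGgen i : star_gen S (S i)
| SGone : star_gen S 1
| SGadd x y : star_gen S x -> star_gen S y -> star_gen S (x + y)
| SGscale (c : R[i]) x : star_gen S x -> star_gen S (c *: x)
| SGmul x y : star_gen S x -> star_gen S y -> star_gen S (x * y)
| SGstar x : star_gen S x -> star_gen S (star x).

Definition smooth_pred (S : 'I_2 -> A) : {pred A} := fun x => `[< star_gen S x >].

Fact smooth_subalg_closed S : subalg_closed (smooth_pred S).
Proof.
split=> [|c x y /asboolP hx /asboolP hy|x y /asboolP hx /asboolP hy].
- by apply/asboolP; constructor.
- by apply/asboolP; constructor=> //; constructor.
- by apply/asboolP; constructor.
Qed.
HB.instance Definition _ S :=
  GRing.isSubalgClosed.Build R[i] A (smooth_pred S)
    (GRing.subalg_closed_semi (smooth_subalg_closed S)).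

End CStarTheory.

Section Smooth.
Context (R : realType) (A : cstarAlgType R) (S : 'I_2 -> A).

Definition smooth := {x : A | x \in smooth_pred S}.
HB.instance Definition _ := Choice.on smooth.
HB.instance Definition _ := SubType.on smooth.
HB.instance Definition _ := [SubChoice_isSubAlgebra of smooth by <:].

Fact smooth_gen_subproof i : S i \in smooth_pred S.
Proof. by apply/asboolP; constructor. Qed.
Definition smooth_gen i : smooth := Sub (S i) (smooth_gen_subproof i).

Fact smooth_star_subproof (x : smooth) : star (val x) \in smooth_pred S.
Proof. by have /asboolP h := valP x; apply/asboolP; constructor. Qed.
Definition smooth_star (x : smooth) : smooth :=
  Sub (star (val x)) (smooth_star_subproof x).

Definition derivation (del : {linear smooth -> smooth}) : Prop :=
  forall x y, del (x * y) = del x * y + x * del y.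

End Smooth.

(* L^2(A, tau0): a Hilbert space with a map from [A], of dense range, under
   which the inner product is tau0 (b^* a), and the representation of [A]
   extending left multiplication. *)
Record gns (R : realType) (A : cstarAlgType R) (tau0 : faithful_state A) := GNS {
  L2 : completeNormedModType R[i];
  L2_dot : {dot L2 for Num.conj};
  L2_norm : forall x : L2, `|x| ^+ 2 = L2_dot x x;
  L2_class : {linear A -> L2};
  L2_class_dot : forall a b,
    L2_dot (L2_class a) (L2_class b) = tau0 (star b * a);
  L2_class_dense : dense (range L2_class);
  L2_act : A -> {linear L2 -> L2};
  L2_act_continuous : forall a, continuous (L2_act a);
  L2_act_class : forall a b, L2_act a (L2_class b) = L2_class (a * b)
}.

Section Canonical.
Context (R : realType) (A : cstarAlgType R) (S : 'I_2 -> A).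
Context (tau0 : faithful_state A) (G : gns tau0).
Context (del : 'I_2 -> {linear smooth S -> smooth S}).
Context (gamma : 'I_2 -> 'M[R[i]]_2).

Local Notation B := (smooth S).
Local Notation cls := (L2_class G).

(* L^2(A, tau0) \otimes C^2 *)
Definition spinors := {ffun 'I_2 -> L2 G}.
HB.instance Definition _ := GRing.Lmodule.on spinors.

(* The domain of the Dirac operator, the image of [B] \otimes C^2.  It is
   dense, so the bounded operators in Pi(Omega_u), all of which preserve it,
   are determined by their restrictions to it. *)
Definition spinor_dom : {pred spinors} := fun xi =>
  `[< exists a : 'I_2 -> B, forall j, xi j = cls (val (a j)) >].

Fact spinor_dom_closed : submod_closed spinor_dom.
Proof.
split=> [|c x y /asboolP[a ha] /asboolP[b hb]]; apply/asboolP.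
  by exists (fun=> 0) => j; rewrite ffunE !raddf0.
by exists (fun j => c *: a j + b j) => j;
  rewrite !ffunE ha hb !linearD !linearZ.
Qed.
HB.instance Definition _ :=
  GRing.isSubmodClosed.Build R[i] spinors spinor_dom
    (GRing.submod_closed_semi spinor_dom_closed).

Definition dirac_dom := {xi : spinors | xi \in spinor_dom}.
HB.instance Definition _ := Choice.on dirac_dom.
HB.instance Definition _ := SubType.on dirac_dom.
HB.instance Definition _ := [SubChoice_isSubLmodule of dirac_dom by <:].

Lemma L2_class_inj : injective cls.
Proof.
move=> a b h; apply/eqP; rewrite -subr_eq0; apply/eqP.
apply: (@fstate_faithful _ _ tau0).
by rewrite -(L2_class_dot G) linearB /= h subrr linear0l.
Qed.

Fact spinor_subproof (a : 'I_2 -> B) : [ffun j => cls (val (a j))] \in spinor_dom.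
Proof. by apply/asboolP; exists a => j; rewrite ffunE. Qed.
Definition spinor (a : 'I_2 -> B) : dirac_dom :=
  Sub ([ffun j => cls (val (a j))] : spinors) (spinor_subproof a).

Definition spinor_coord (xi : dirac_dom) : 'I_2 -> B :=
  sval (cid (asboolP _ (valP xi))).

Lemma spinor_coordP (xi : dirac_dom) j : val xi j = cls (val (spinor_coord xi j)).
Proof. exact: svalP (cid (asboolP _ (valP xi))) j. Qed.

Lemma spinor_coordK (a : 'I_2 -> B) j : spinor_coord (spinor a) j = a j.
Proof.
by apply/val_inj/L2_class_inj; rewrite -spinor_coordP SubK ffunE.
Qed.

Lemma dirac_dom_ext (xi eta : dirac_dom) :
  (forall j, val xi j = val eta j) -> xi = eta.
Proof. by move=> h; apply/val_inj/ffunP. Qed.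

Lemma spinor_coord_linear (c : R[i]) xi eta j :
  spinor_coord (c *: xi + eta) j = c *: spinor_coord xi j + spinor_coord eta j.
Proof.
apply/val_inj/L2_class_inj; rewrite -spinor_coordP.
by rewrite !linearD !linearZ /= !ffunE !spinor_coordP.
Qed.

Lemma spinor_linear (c : R[i]) a b :
  spinor (fun j => c *: a j + b j) = c *: spinor a + spinor b.
Proof.
by apply: dirac_dom_ext => j; rewrite linearD linearZ /= !ffunE !linearD !linearZ.
Qed.

(* \partial_1 \otimes \gamma_1 + \partial_2 \otimes \gamma_2 *)
Definition dirac_op (xi : dirac_dom) : dirac_dom :=
  spinor (fun i => \sum_(m < 2) \sum_(j < 2)
                     gamma m i j *: del m (spinor_coord xi j)).

Fact dirac_op_linear : linear dirac_op.
Proof.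
move=> c xi eta; rewrite -spinor_linear; congr spinor; apply/funext => i.
rewrite scaler_sumr -big_split; apply: eq_bigr => m _ /=.
rewrite scaler_sumr -big_split; apply: eq_bigr => j _ /=.
by rewrite spinor_coord_linear linearD linearZ /= scalerDr !scalerA mulrC.
Qed.
HB.instance Definition _ :=
  GRing.isLinear.Build R[i] dirac_dom dirac_dom _ dirac_op dirac_op_linear.

(* a \otimes 1 *)
Fact act_op_subproof (a : B) (xi : dirac_dom) :
  [ffun j => L2_act G (val a) (val xi j)] \in spinor_dom.
Proof.
apply/asboolP; exists (fun j => a * spinor_coord xi j) => j.
by rewrite ffunE spinor_coordP L2_act_class.
Qed.
Definition act_op (a : B) (xi : dirac_dom) : dirac_dom :=
  Sub ([ffun j => L2_act G (val a) (val xi j)] : spinors)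
    (act_op_subproof a xi).

Fact act_op_linear a : linear (act_op a).
Proof.
move=> c xi eta; apply: dirac_dom_ext => j.
by rewrite linearD linearZ /= !ffunE linearD linearZ.
Qed.
HB.instance Definition _ a :=
  GRing.isLinear.Build R[i] dirac_dom dirac_dom _ (act_op a) (act_op_linear a).

(* 1 \otimes \gamma_m *)
Fact gamma_op_subproof m (xi : dirac_dom) :
  [ffun i => \sum_(j < 2) gamma m i j *: val xi j] \in spinor_dom.
Proof.
apply/asboolP.
exists (fun i => \sum_(j < 2) gamma m i j *: spinor_coord xi j) => i.
rewrite ffunE raddf_sum /= raddf_sum /=; apply: eq_bigr => j _.
by rewrite linearZ /= spinor_coordP.
Qed.
Definition gamma_op m (xi : dirac_dom) : dirac_dom :=
  Sub ([ffun i => \sum_(j < 2) gamma m i j *: val xi j] : spinors)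
    (gamma_op_subproof m xi).

Fact act_opD a b xi : act_op (a + b) xi = act_op a xi + act_op b xi.
Proof.
apply: dirac_dom_ext => j; rewrite linearD /= !ffunE.
by rewrite !spinor_coordP !L2_act_class mulrDl linearD.
Qed.
Fact act_opZ c a xi : act_op (c *: a) xi = c *: act_op a xi.
Proof.
apply: dirac_dom_ext => j; rewrite linearZ /= !ffunE.
by rewrite !spinor_coordP !L2_act_class -scalerAl linearZ.
Qed.
Fact act_op1 xi : act_op 1 xi = xi.
Proof.
apply: dirac_dom_ext => j.
by rewrite /= !ffunE !spinor_coordP !L2_act_class mul1r.
Qed.
Fact act_opM a b xi : act_op (a * b) xi = act_op a (act_op b xi).
Proof.
apply: dirac_dom_ext => j.
by rewrite /= !ffunE !spinor_coordP !L2_act_class mulrA.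
Qed.

Definition canonical_module : dirac_module B :=
  @DiracModule _ _ dirac_dom (fun a => act_op a) dirac_op
    act_opD act_opZ act_op1 act_opM.

Definition canonical_calculus : calculus B := connes_calculus canonical_module.

Local Notation Omega := canonical_calculus.
Local Notation Omega1 := (form1 Omega).
Local Notation Omega2 := (form2 Omega).
Local Notation i1 := (ord0 : 'I_2).
Local Notation i2 := (ord_max : 'I_2).

(* 1 \otimes \gamma_m as a one-form; it is S_m^* [D, S_m] when the S_m are
   isometries and del_i(S_j) = \delta_ij S_i. *)
Definition basis_form (m : 'I_2) : Omega1 := 
  @op_class _ _ canonical_module 1 (gamma_op m).

Local Notation e := basis_form.
Local Notation T2 := (bitensor Omega1 Omega1).

Definition tensor_coords (a : 'I_2 -> 'I_2 -> B) : T2 :=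
  \sum_(i < 2) \sum_(j < 2) ract (e i ⊗ e j) (a i j).

Definition deformation_parameter (k : B) : Prop :=
  exists l : B, k * l = 1 /\ l * k = 1.

(* k g_0 *)
Definition deformed_metric (k : B) : T2 -> B :=
  xget (fun=> 0) [set g |
    [/\ pseudo_riemannian g, strongly_sigma_compatible g
      & forall a, g (tensor_coords a) = \sum_(i < 2) k * a i i]].

(* [christoffel nabla i j l] is \Gamma^i_{jl}. *)
Definition christoffel (nabla : Omega1 -> T2) : 'I_2 -> 'I_2 -> 'I_2 -> B :=
  xget (fun _ _ _ => 0) [set Gam | forall i, nabla (e i) = tensor_coords (Gam i)].

Definition volume_form : Omega2 := wedge (e i1) (e i2).

(* \Omega^k_{12} *)
Definition curvature12 (k : B) : Omega2 :=
  let Gam := christoffel (levi_civita (deformed_metric k)) in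
  ract volume_form
    (\sum_(p < 2) (Gam p i2 i1 * Gam i1 p i2 - Gam p i2 i2 * Gam i1 p i1)
     - del i2 (Gam i1 i2 i1) + del i1 (Gam i1 i2 i2)).

(* The integral over tau of e_1 \wedge e_2 a is tau(a). *)
Definition integral2 (tau : {scalar A}) (theta : Omega2) : R[i] :=
  tau (val (xget 0 [set a | theta = ract volume_form a])).

End Canonical.

(* Main.v *)
Require Import Defs.
From HB Require Import structures.
From mathcomp Require Import all_boot all_order all_algebra.
From mathcomp Require Import complex.
From mathcomp Require Import all_classical all_reals all_analysis.

Set Implicit Arguments.
Unset Strict Implicit.
Unset Printing Implicit Defensive.

Import Order.TTheory GRing.Theory Num.Theory.
Local Open Scope ring_scope.

(* At k = 1 the metric is the flat metric g_0, whose Levi-Civita connection has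
   vanishing Christoffel symbols, so the integral at k = 1 is 0 and independence
   of k gives the claim.  The substance is that the choices made by [xget] in
   the definitions are the intended ones at k = 1: the canonical calculus has
   to be computed from Connes' quotient.  The forms e_1, e_2 are a central basis
   because S_i^* [D, S_i] = gamma_i.  An element of Pi(delta J_0^1) has no
   gamma_1 gamma_2 component, since del_1 and del_2 commute, and scalar junk
   does occur; hence e_i /\ e_i = 0 and e_1 /\ e_2 is free. *)

(** * Sums over two indices, halving, and additive maps on tensor products *)

Lemma sum_I2 (V : nmodType) (F : 'I_2 -> V) :
  \sum_(i < 2) F i = F ord0 + F ord_max.
Proof.
rewrite big_ord_recl big_ord_recl big_ord0 addr0.
by congr (_ + F _); apply: val_inj.
Qed.

Lemma I2_cases (i : 'I_2) : i = ord0 \/ i = ord_max.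
Proof. by case: i => [[|[|]]] // h; [left|right]; apply: val_inj. Qed.

Section Halves.
Context (K : fieldType) (two_neq0 : 2%:R != 0 :> K) (V : lmodType K).

Lemma scale_half_double (x : V) : 2^-1 *: (x + x) = x.
Proof. by rewrite -mulr2n -scaler_nat scalerA mulVf // scale1r. Qed.

Lemma oppr_fixed_eq0 (x : V) : x = - x -> x = 0.
Proof. by move=> xN; rewrite -[x]scale_half_double {2}xN subrr scaler0. Qed.

End Halves.

Section AdditiveTensor.
Context (K : Type) (M N : zmodType) (rM : M -> K -> M) (lN : K -> N -> N).

(** Elementary tensors generate the group. The target group and the balancing actions are arbitrary,
    unlike in [bitensor_ext], so that this also covers metrics, two-forms and the tensor product
    over the centre. *)
Lemma tens_ext (G : zmodType) (f g : tensor rM lN -> G) :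
  {morph f : x y / x + y} -> {morph g : x y / x + y} ->
  (forall m n, f (tens rM lN m n) = g (tens rM lN m n)) -> f =1 g.
Proof.
move=> fD gD fg x; have [s ->] := tensor_ind_sum x.
have f0 : f 0 = 0 by apply: (addIr (f 0)); rewrite -fD !add0r.
have g0 : g 0 = 0 by apply: (addIr (g 0)); rewrite -gD !add0r.
by elim: s => [|p s IHs]; rewrite ?big_nil ?f0 ?g0 // big_cons fD gD IHs fg.
Qed.

Lemma tens_sumr I (r : seq I) (F : I -> N) m :
  tens rM lN m (\sum_(i <- r) F i) = \sum_(i <- r) tens rM lN m (F i).
Proof.
have Dr := balancedDr (tens_balanced rM lN).
apply: (big_morph _ (Dr m)).
by apply: (addIr (tens rM lN m 0)); rewrite -Dr !add0r.
Qed.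

Lemma tens_suml I (r : seq I) (F : I -> M) n :
  tens rM lN (\sum_(i <- r) F i) n = \sum_(i <- r) tens rM lN (F i) n.
Proof.
have Dl := balancedDl (tens_balanced rM lN).
apply: (big_morph (fun m => tens rM lN m n)) => [m m'|]; first exact: Dl.
by apply: (addIr (tens rM lN 0 n)); rewrite -Dl !add0r.
Qed.

End AdditiveTensor.

Lemma additive_sum (U V : zmodType) (f : U -> V) :
  {morph f : x y / x + y} ->
  forall I (r : seq I) F, f (\sum_(i <- r) F i) = \sum_(i <- r) f (F i).
Proof.
move=> fD I r F; apply: (big_morph f fD).
by apply: (addIr (f 0)); rewrite -fD !add0r.
Qed.

(** * Bimodules with a finite central basis, and their tensor squares *)

Section CentralBasis.
Context (K : fieldType) (B : algType K) (M : bimodType B) (n : nat).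
Context (e : 'I_n -> M).

Definition comb (a : 'I_n -> B) : M := \sum_(i < n) ract (e i) (a i).

Record central_basis : Prop := CentralBasis {
  basis_central : forall i a, lact a (e i) = ract (e i) a;
  basis_span : forall x, exists a, x = comb a;
  comb_free : forall a, comb a = 0 -> forall i, a i = 0 }.

Context (eb : central_basis).

Lemma combD a b : comb (fun i => a i + b i) = comb a + comb b.
Proof. by rewrite -big_split; apply: eq_bigr => i _; rewrite ractDr. Qed.

Lemma comb_ract a b : ract (comb a) b = comb (fun i => a i * b).
Proof. by rewrite ract_sum; apply: eq_bigr => i _; rewrite ractA. Qed.

Lemma comb_lact a b : lact b (comb a) = comb (fun i => b * a i).
Proof.
rewrite lact_sum; apply: eq_bigr => i _.
by rewrite -lractA (basis_central eb) ractA.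
Qed.

Lemma eq_comb a b : a =1 b -> comb a = comb b.
Proof. by move=> ab; apply: eq_bigr => i _; rewrite ab. Qed.

Lemma comb_inj a b : comb a = comb b -> a =1 b.
Proof.
move=> ab i; apply/eqP; rewrite -subr_eq0; apply/eqP; move: i.
apply: (comb_free eb); apply: (addIr (comb b)).
by rewrite add0r -combD -ab; apply: eq_comb => i; rewrite subrK.
Qed.

Definition bcoord (x : M) : 'I_n -> B := sval (cid (basis_span eb x)).

Lemma bcoordK x : comb (bcoord x) = x.
Proof. by rewrite /bcoord; case: cid => a. Qed.

Lemma bcoord_comb a : bcoord (comb a) =1 a.
Proof. by apply: comb_inj; rewrite bcoordK. Qed.

Lemma bcoordD x y i : bcoord (x + y) i = bcoord x i + bcoord y i.
Proof.
by rewrite -{1}(bcoordK x) -{1}(bcoordK y) -combD bcoord_comb.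
Qed.

Lemma bcoord_ract x a i : bcoord (ract x a) i = bcoord x i * a.
Proof. by rewrite -{1}(bcoordK x) comb_ract bcoord_comb. Qed.

Lemma bcoord_lact x a i : bcoord (lact a x) i = a * bcoord x i.
Proof. by rewrite -{1}(bcoordK x) comb_lact bcoord_comb. Qed.

Lemma comb_delta i a : comb (fun j => (i == j)%:R * a) = ract (e i) a.
Proof.
rewrite /comb (bigD1 i) //= eqxx mul1r big1 ?addr0 // => j /negbTE ij.
by rewrite eq_sym ij mul0r; apply: (addIr (ract (e j) 0)); rewrite -ractDr !add0r.
Qed.

Lemma bcoord_basis i j : bcoord (e i) j = (i == j)%:R.
Proof. by rewrite -[e i]ract1 -comb_delta bcoord_comb mulr1. Qed.

(** Over a central basis, left and right multiplication by [a] act coordinatewise on the same side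
    as on [M]; they agree on a central [x], so its coordinates lie in the centre of [B]. *)
Lemma bcoord_central x i a : x \in @central K B M -> GRing.comm a (bcoord x i).
Proof.
by move=> /asboolP/(_ a) h; rewrite /GRing.comm -bcoord_lact h bcoord_ract.
Qed.

Definition tensor_comb (a : 'I_n -> 'I_n -> B) : bitensor M M :=
  \sum_(i < n) \sum_(j < n) ract (e i ⊗ e j) (a i j).

Lemma tensor_combD a b :
  tensor_comb (fun i j => a i j + b i j) = tensor_comb a + tensor_comb b.
Proof.
rewrite -big_split; apply: eq_bigr => i _ /=.
by rewrite -big_split; apply: eq_bigr => j _; rewrite ractDr.
Qed.

Lemma eq_tensor_comb a b : (forall i j, a i j = b i j) ->
  tensor_comb a = tensor_comb b.
Proof.
by move=> ab; apply: eq_bigr => i _; apply: eq_bigr => j _; rewrite ab.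
Qed.

Lemma tensor_comb_ract a b :
  ract (tensor_comb a) b = tensor_comb (fun i j => a i j * b).
Proof.
rewrite ract_sum; apply: eq_bigr => i _.
by rewrite ract_sum; apply: eq_bigr => j _; rewrite ractA.
Qed.

Lemma basis_tens_central i j a : lact a (e i ⊗ e j) = ract (e i ⊗ e j) a.
Proof.
rewrite [LHS]bitensor_lact_tens [RHS]bitensor_ract_tens (basis_central eb).
by rewrite (balancedM (btens_balanced M M)) (basis_central eb).
Qed.

Lemma tensor_comb_lact a b :
  lact b (tensor_comb a) = tensor_comb (fun i j => b * a i j).
Proof.
rewrite lact_sum; apply: eq_bigr => i _.
rewrite lact_sum; apply: eq_bigr => j _.
by rewrite -lractA basis_tens_central ractA.
Qed.

(** The coefficients of [x] cross the tensor sign by balancedness and then pass each [e j] by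
    centrality. *)
Lemma btens_coord x y :
  x ⊗ y = tensor_comb (fun i j => bcoord x i * bcoord y j).
Proof.
rewrite -{1}(bcoordK x) -{1}(bcoordK y) /comb [LHS]tens_suml.
apply: eq_bigr => i _; rewrite tens_sumr; apply: eq_bigr => j _.
rewrite (balancedM (tens_balanced _ _)) -lractA (basis_central eb) ractA.
exact: (esym (bitensor_ract_tens _ _ _)).
Qed.

(** The lift is meaningful because (xa)_i = x_i a and (ay)_j = a y_j. These functionals are what
    proves the tensors [e i ⊗ e j] free. *)
Definition tensor_coord (i j : 'I_n) : bitensor M M -> B :=
  tens_lift (fun x y => bcoord x i * bcoord y j).

Lemma tensor_coord_balanced i j :
  balanced (@ract K B M) (@lact K B M) (fun x y => bcoord x i * bcoord y j).
Proof.
split=> [x x' y|x y y'|x a y]; first by rewrite bcoordD mulrDl.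
  by rewrite bcoordD mulrDr.
by rewrite bcoord_ract bcoord_lact mulrA.
Qed.

Lemma tensor_coord_tens i j x y :
  tensor_coord i j (x ⊗ y) = bcoord x i * bcoord y j.
Proof. exact/tens_lift_tens/tensor_coord_balanced. Qed.

Lemma tensor_coordD i j : {morph tensor_coord i j : x y / x + y}.
Proof. by move=> x y; apply/tens_liftD/tensor_coord_balanced. Qed.

Lemma tensor_coord_comb a i j : tensor_coord i j (tensor_comb a) = a i j.
Proof.
have Ds := additive_sum (tensor_coordD i j).
rewrite Ds (bigD1 i) //= Ds (bigD1 j) //= big1 => [|l /negbTE lj].
  rewrite [ract _ _]bitensor_ract_tens tensor_coord_tens bcoord_ract !bcoord_basis.
  rewrite !eqxx !mul1r addr0 big1 ?addr0 // => l /negbTE li.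
  rewrite Ds big1 // => m _.
  by rewrite [ract _ _]bitensor_ract_tens tensor_coord_tens bcoord_basis li mul0r.
rewrite [ract _ _]bitensor_ract_tens tensor_coord_tens bcoord_ract !bcoord_basis.
by rewrite lj mul0r mulr0.
Qed.

Lemma tensor_coordK x : tensor_comb (fun i j => tensor_coord i j x) = x.
Proof.
apply: (tens_ext (f := fun x => tensor_comb (fun i j => tensor_coord i j x))
  (g := id)) x => [x y||x y] //.
  by rewrite -tensor_combD; apply: eq_tensor_comb => i j; rewrite tensor_coordD.
rewrite -[tens _ _ x y]/(x ⊗ y) [RHS]btens_coord.
by apply: eq_tensor_comb => i j; rewrite tensor_coord_tens.
Qed.

Lemma tensor_coord_inj x y :
  (forall i j, tensor_coord i j x = tensor_coord i j y) -> x = y.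
Proof.
by move=> xy; rewrite -(tensor_coordK x) -(tensor_coordK y);
  apply: eq_tensor_comb.
Qed.

Lemma tensor_coord_ract i j x a :
  tensor_coord i j (ract x a) = tensor_coord i j x * a.
Proof. by rewrite -{1}(tensor_coordK x) tensor_comb_ract tensor_coord_comb. Qed.

Lemma tensor_coord_lact i j x a :
  tensor_coord i j (lact a x) = a * tensor_coord i j x.
Proof. by rewrite -{1}(tensor_coordK x) tensor_comb_lact tensor_coord_comb. Qed.

Lemma fg_projective_basis : fg_projective M.
Proof.
exists n, (fun x => [ffun i => bcoord x i]), (fun u => comb u); split.
- split=> [x y|x a]; apply/ffunP => i; rewrite !ffunE ?bcoordD ?bcoord_ract //.
- split=> [u v|u a]; first by rewrite -combD; apply: eq_comb => i; rewrite ffunE.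
  by rewrite comb_ract; apply: eq_comb => i; rewrite ffunE.
- by move=> x; rewrite -[RHS]bcoordK; apply: eq_comb => i; rewrite ffunE.
Qed.

Lemma basis_in_central i : e i \in @central K B M.
Proof. by apply/asboolP => a; rewrite (basis_central eb). Qed.

Lemma centre_mult_balanced :
  balanced (@centre_ract K B M) (fun (z : centre_alg B) (a : B) => val z * a)
    (fun x a => ract (val x) a).
Proof.
split=> [x y a|x a b|x z a]; first by rewrite raddfD ractDl.
  by rewrite ractDr.
by rewrite -ractA.
Qed.

(** The inverse sends x to the sum of the [e i] ⊗ x_i. For x ⊗ a with x central, the coordinates of
    x are central, so they can be moved back to the left factor, where they reassemble x. *)
Lemma centre_mult_bij : bijective (@centre_mult K B M).
Proof.
pose ec i : centre M := Sub (e i) (basis_in_central i).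
pose T := tens (@centre_ract K B M) (fun (z : centre_alg B) (a : B) => val z * a).
pose h x := \sum_(i < n) T (ec i) (bcoord x i).
have TB : balanced _ _ T := tens_balanced _ _.
have mD : {morph @centre_mult K B M : x y / x + y}.
  by move=> x y; apply/tens_liftD/centre_mult_balanced.
have mT x a : centre_mult (T x a) = ract (val x) a.
  exact/tens_lift_tens/centre_mult_balanced.
exists h => [t|x]; last first.
  rewrite (additive_sum mD) -[RHS]bcoordK.
  by apply: eq_bigr => i _; rewrite mT.
apply: (tens_ext (f := fun t => h (centre_mult t)) (g := id)) t
  => [t u||x a] //.
  rewrite mD /h -big_split; apply: eq_bigr => i _.
  by rewrite bcoordD (balancedDr TB).
rewrite -/(T x a) mT /h.
have zP i : `[< forall b, bcoord (val x) i * b = b * bcoord (val x) i >].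
  by apply/asboolP => b; apply/esym/bcoord_central/valP.
pose z i : centre_alg B :=
  exist (fun c : B => `[< forall b, c * b = b * c >]) _ (zP i).
transitivity (\sum_(i < n) T (centre_ract (ec i) (z i)) a).
  by apply: eq_bigr => i _; rewrite (balancedM TB) bcoord_ract.
rewrite -tens_suml; congr (T _ a); apply: val_inj.
by rewrite raddf_sum -[RHS]bcoordK.
Qed.

End CentralBasis.

(** * Calculi of rank two: the wedge product, tameness and the flip *)

Section RankTwoCalculus.
Context (K : fieldType) (B : algType K) (Omega : calculus B).
Context (e : 'I_2 -> form1 Omega).
Local Notation Omega1 := (form1 Omega).
Local Notation Omega2 := (form2 Omega).
Local Notation T2 := (bitensor Omega1 Omega1).
Local Notation vol := (wedge (e ord0) (e ord_max)).

(** These properties are the interface between the operator computation in Connes' quotient and the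
    study of metrics and connections. That [vol] spans the two-forms follows from [form2_gen], see
    [volume_span]. *)
Record rank_two : Prop := RankTwo {
  rank_two_basis :> central_basis e;
  wedge_basis_sq : forall i, wedge (e i) (e i) = 0;
  wedge_basis_anti : wedge (e ord_max) (e ord0) = - vol;
  volume_free : forall a, ract vol a = 0 -> a = 0;
  d1_basis : forall i, d1 (e i) = 0 }.

Context (two_neq0 : 2%:R != 0 :> K) (rt : rank_two).
Local Notation eb := (rank_two_basis rt).
Local Notation bcoord := (bcoord eb).
Local Notation tcoord := (tensor_coord eb).

Lemma volume_inj a b : ract vol a = ract vol b -> a = b.
Proof.
move=> ab; apply/eqP; rewrite -subr_eq0; apply/eqP/(volume_free rt).
rewrite ractDr ab; apply: (addIr (ract vol b)).
by rewrite -addrA -ractDr addNr add0r -[in LHS](addr0 b) -ractDr addr0 addr0.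
Qed.

Lemma wedge_tensorD : {morph @wedge_tensor K B Omega : x y / x + y}.
Proof. by move=> x y; apply/tens_liftD/wedge_balanced. Qed.

Lemma wedge_tensor_tens (x y : Omega1) : wedge_tensor (x ⊗ y) = wedge x y.
Proof. exact/tens_lift_tens/wedge_balanced. Qed.

Lemma wedge_tensor_ract (x : T2) a :
  wedge_tensor (ract x a) = ract (wedge_tensor x) a.
Proof.
apply: (tens_ext (f := fun x => wedge_tensor (ract (x : T2) a))
  (g := fun x => ract (wedge_tensor x) a)) x => [x y|x y|x y].
- by rewrite -wedge_tensorD -ractDl.
- by rewrite wedge_tensorD ractDl.
- rewrite -[tens _ _ x y]/(x ⊗ y) [ract (_ ⊗ _) _]bitensor_ract_tens.
  by rewrite !wedge_tensor_tens wedge_ract.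
Qed.

(** The diagonal terms vanish and the two off-diagonal ones combine by anticommutation. Freeness of
    [vol] then identifies the kernel of the wedge with the symmetric coordinate matrices. *)
Lemma wedge_tensorE (x : T2) :
  wedge_tensor x =
  ract vol (tcoord ord0 ord_max x - tcoord ord_max ord0 x).
Proof.
have Ds := additive_sum wedge_tensorD.
rewrite -{1}(tensor_coordK eb x) Ds sum_I2 !Ds !sum_I2.
rewrite !wedge_tensor_ract !wedge_tensor_tens !(wedge_basis_sq rt) !ract0l.
rewrite (wedge_basis_anti rt) add0r addr0 ractDr; congr (_ + _).
apply: (addIr (ract vol (tcoord ord_max ord0 x))).
by rewrite -ractDl -ractDr !addNr ract0l;
  apply: (addIr (ract vol 0)); rewrite -ractDr !add0r.
Qed.

Lemma volume_span (t : Omega2) : exists a, t = ract vol a.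
Proof.
have [s ->] := form2_gen t.
exists (\sum_(p <- s) (tcoord ord0 ord_max (p.1 ⊗ p.2) -
                        tcoord ord_max ord0 (p.1 ⊗ p.2))).
rewrite (additive_sum (ractDr vol)).
by apply: eq_bigr => p _; rewrite -wedge_tensorE wedge_tensor_tens.
Qed.

(** The candidate for P_sym. It is built from coordinates in the central basis, because the flip of
    elementary tensors is not balanced over a noncommutative [B]. *)
Definition symmetrise (x : T2) : T2 :=
  tensor_comb e (fun i j => 2^-1 *: (tcoord i j x + tcoord j i x)).

Lemma tcoord_symmetrise i j x :
  tcoord i j (symmetrise x) = 2^-1 *: (tcoord i j x + tcoord j i x).
Proof. exact: tensor_coord_comb. Qed.

Lemma symmetriseD : {morph symmetrise : x y / x + y}.
Proof.
move=> x y; apply: (tensor_coord_inj (eb := eb)) => i j.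
rewrite tensor_coordD !tcoord_symmetrise !tensor_coordD -scalerDr.
by rewrite addrACA.
Qed.

Lemma symmetrise_bimodule_map : bimodule_map symmetrise.
Proof.
split; split; try exact: symmetriseD.
  move=> a x; apply: (tensor_coord_inj (eb := eb)) => i j.
  rewrite tensor_coord_lact !tcoord_symmetrise !tensor_coord_lact.
  by rewrite -mulrDr scalerAr.
move=> x a; apply: (tensor_coord_inj (eb := eb)) => i j.
rewrite tensor_coord_ract !tcoord_symmetrise !tensor_coord_ract.
by rewrite -mulrDl scalerAl.
Qed.

Lemma symmetrise_idem x : symmetrise (symmetrise x) = symmetrise x.
Proof.
apply: (tensor_coord_inj (eb := eb)) => i j; rewrite !tcoord_symmetrise.
by rewrite [tcoord j i x + _]addrC (scale_half_double two_neq0).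
Qed.

Lemma wedge_eq0P (x : T2) :
  wedge_tensor x = 0 <-> forall i j, tcoord i j x = tcoord j i x.
Proof.
rewrite wedge_tensorE; split=> [/(volume_free rt)/eqP|->]; last first.
  by rewrite subrr; apply: (addIr (ract vol 0)); rewrite -ractDr !add0r.
rewrite subr_eq0 => /eqP h i j.
by case: (I2_cases i) => ->; case: (I2_cases j) => ->.
Qed.

(** These tensors form the complement F of the kernel of the wedge. The wedge of such a tensor is
    [vol] times 2a. *)
Definition antisymmetric (a : B) : T2 :=
  tensor_comb e (fun i j => a *+ (i < j) - a *+ (j < i)).

Lemma tcoord_antisymmetric i j a :
  tcoord i j (antisymmetric a) = a *+ (i < j) - a *+ (j < i).
Proof. exact: tensor_coord_comb. Qed.

Lemma symmetrise_quasi_tame : quasi_tame symmetrise.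
Proof.
split; first exact: fg_projective_basis eb.
- exact: symmetrise_bimodule_map.
- exact: symmetrise_idem.
- apply/seteqP; split=> [_ [x _ <-]|x /= /wedge_eq0P h] /=.
    by apply/wedge_eq0P => i j; rewrite !tcoord_symmetrise addrC.
  exists x => //; apply: (tensor_coord_inj (eb := eb)) => i j.
  by rewrite tcoord_symmetrise h (scale_half_double two_neq0).
pose v t : B := sval (cid (volume_span t)).
have vP t : t = ract vol (v t) by rewrite /v; case: cid.
have phiD t u : v (t + u) = v t + v u.
  by apply: volume_inj; rewrite ractDr -!vP.
(* This map inverts the wedge on F only up to the factor 2, which is enough for an isomorphism onto
   F. *)
exists (fun t => antisymmetric (v t)); split.
- split=> [t u|t a]; apply: (tensor_coord_inj (eb := eb)) => i j.
    rewrite tensor_coordD !tcoord_antisymmetric phiD.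
    by rewrite !mulrnDl opprD addrACA.
  rewrite tensor_coord_ract !tcoord_antisymmetric.
  have -> : v (ract t a) = v t * a.
    by apply: volume_inj; rewrite -ractA -!vP.
  by rewrite mulrBl !mulrnAl.
- move=> t u /(congr1 (tcoord ord0 ord_max)); rewrite !tcoord_antisymmetric /=.
  by rewrite !subr0 => vtu; rewrite (vP t) (vP u); congr (ract _ _).
apply/seteqP; split=> [_ [t _ <-]|x /= x0] /=.
  apply: (tensor_coord_inj (eb := eb)) => i j; rewrite tcoord_symmetrise.
  rewrite !tcoord_antisymmetric -[X in _ + X]opprB subrr scaler0.
  by apply: (addIr (tcoord i j 0)); rewrite -tensor_coordD !add0r.
(* The sum of the two coordinates is twice a coordinate of [symmetrise x], which is zero. *)
have xN i j : tcoord i j x = - tcoord j i x.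
  apply/eqP; rewrite -addr_eq0 -[_ + _](scale_half_double two_neq0).
  rewrite -mulr2n -scaler_nat scalerA.
  rewrite mulrC -scalerA -tcoord_symmetrise x0.
  rewrite (_ : tcoord i j 0 = 0) ?scaler0 //.
  by apply: (addIr (tcoord i j 0)); rewrite -tensor_coordD !add0r.
(* This is [vol] times the upper off-diagonal coordinate of x; the half offsets the two equal
   contributions to the wedge. *)
exists (wedge_tensor (antisymmetric (2^-1 *: tcoord ord0 ord_max x))) => //.
have -> : v (wedge_tensor (antisymmetric (2^-1 *: tcoord ord0 ord_max x))) =
    tcoord ord0 ord_max x.
  apply: volume_inj; rewrite -vP wedge_tensorE !tcoord_antisymmetric /=.
  by rewrite subr0 sub0r opprK -scalerDr (scale_half_double two_neq0).
apply: (tensor_coord_inj (eb := eb)) => i j; rewrite tcoord_antisymmetric.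
case: (I2_cases i) => ->; case: (I2_cases j) => -> /=.
- by rewrite subr0 [RHS](oppr_fixed_eq0 two_neq0).
- by rewrite subr0.
- by rewrite sub0r -xN.
- by rewrite subr0 [RHS](oppr_fixed_eq0 two_neq0).
Qed.

(** The map 2P - 1 transposes the coordinate matrix. Coordinates of central forms commute, so for
    them the transpose is the matrix of the flipped tensor. *)
Lemma symmetrise_tame : tame symmetrise.
Proof.
split; [exact: symmetrise_quasi_tame | exact: centre_mult_bij eb |].
move=> w h; apply: (tensor_coord_inj (eb := eb)) => i j.
rewrite /sigma_of; set x := _ ⊗ _.
have -> : tcoord i j (symmetrise x *+ 2 - x) = tcoord j i x.
  apply: (addIr (tcoord i j x)); rewrite -tensor_coordD subrK mulr2n.
  rewrite tensor_coordD !tcoord_symmetrise -scalerDr.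
  by rewrite (scale_half_double two_neq0) addrC.
by rewrite !tensor_coord_tens (bcoord_central eb _ _ (valP w)).
Qed.

(** Existence of a tame idempotent makes the choice in [Psym] meaningful. From here on [sigma] is
    handled through tameness alone: bilinearity and the flip of central forms fix it on the basis,
    see [tcoord_sigma]. *)
Lemma Psym_tame : tame (@Psym K B Omega).
Proof.
apply: (@xgetPex _ _ [set P | tame P]); exists symmetrise.
exact: symmetrise_tame.
Qed.

Lemma sigmaD : {morph @sigma K B Omega : x y / x + y}.
Proof.
have [[_ [[PD _] _] _ _ _] _ _] := Psym_tame.
by move=> x y; rewrite /sigma /sigma_of PD mulrnDl opprD addrACA.
Qed.

Lemma sigma_ract (x : T2) a : sigma (ract x a) = ract (sigma x) a.
Proof.
have [[_ [_ [_ Pr]] _ _ _] _ _] := Psym_tame.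
by rewrite /sigma /sigma_of Pr !mulr2n ractDl ractNl ractDl.
Qed.

Lemma sigma_lact (x : T2) a : sigma (lact a x) = lact a (sigma x).
Proof.
have [[_ [[_ Pl] _] _ _ _] _ _] := Psym_tame.
by rewrite /sigma /sigma_of Pl !mulr2n lactDr lactNr lactDr.
Qed.

Lemma sigma_central (x y : Omega1) :
  x \in @central K B Omega1 -> y \in @central K B Omega1 ->
  sigma (x ⊗ y) = y ⊗ x.
Proof.
move=> xc yc; have [_ _ sc] := Psym_tame.
exact: (sc (exist _ x xc) (exist _ y yc)).
Qed.

Lemma sigma_basis i j : sigma (e i ⊗ e j) = e j ⊗ e i.
Proof. by apply: sigma_central; apply: (basis_in_central eb). Qed.

Lemma tcoord_sigma i j (x : T2) : tcoord i j (sigma x) = tcoord j i x.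
Proof.
rewrite -{1}(tensor_coordK eb x) /tensor_comb.
rewrite (additive_sum sigmaD).
rewrite (eq_bigr (fun i => \sum_(j < 2) ract (e j ⊗ e i) (tcoord i j x))).
  by rewrite exchange_big; apply: (tensor_coord_comb eb (fun i j => _)).
move=> k _; rewrite (additive_sum sigmaD); apply: eq_bigr => l _.
by rewrite sigma_ract sigma_basis.
Qed.

(** * The trace metric *)

Definition trace_metric (x : T2) : B := \sum_(i < 2) tcoord i i x.

Lemma trace_metric_tens x y :
  trace_metric (x ⊗ y) = \sum_(i < 2) bcoord x i * bcoord y i.
Proof. by apply: eq_bigr => i _; rewrite tensor_coord_tens. Qed.

Lemma trace_metric_comb a :
  trace_metric (tensor_comb e a) = \sum_(i < 2) a i i.
Proof. by apply: eq_bigr => i _; rewrite tensor_coord_comb. Qed.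

Lemma trace_metric_functional : right_functional trace_metric.
Proof.
split=> [x y|x a]; rewrite /trace_metric.
  by rewrite -big_split; apply: eq_bigr => i _; rewrite tensor_coordD.
by rewrite mulr_suml; apply: eq_bigr => i _; rewrite tensor_coord_ract.
Qed.

Lemma trace_metric_tens_basis x j : trace_metric (x ⊗ e j) = bcoord x j.
Proof.
rewrite trace_metric_tens (bigD1 j) //= bcoord_basis eqxx mulr1.
rewrite big1 ?addr0 // => i /negbTE ij.
by rewrite bcoord_basis eq_sym ij mulr0.
Qed.

(** The basis is orthonormal: pairing with [e i] reads off a coordinate, and the one-form
    representing [f] has the coordinates [f (e i)]. *)
Lemma trace_metric_riemannian : pseudo_riemannian trace_metric.
Proof.
split; first exact: trace_metric_functional.
- by move=> x; apply: eq_bigr => i _; rewrite tcoord_sigma.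
- move=> w h wh; rewrite -(bcoordK eb w) -(bcoordK eb h); apply: eq_comb => i.
  by rewrite -!trace_metric_tens_basis; apply: (congr1 (@^~ (e i)) wh).
move=> f [fD fr]; exists (comb e (fun i => f (e i))) => h.
rewrite trace_metric_tens -{1}(bcoordK eb h) (additive_sum fD).
by apply: eq_bigr => i _; rewrite fr bcoord_comb.
Qed.

Lemma trace_metric_compatible : strongly_sigma_compatible trace_metric.
Proof.
move=> w h w' h'; rewrite !trace_metric_tens; apply: commr_sum => i _.
by apply: commrM; apply: bcoord_central; apply: valP.
Qed.

(** * Christoffel symbols of a Levi-Civita connection of the trace metric *)

Section LeviCivita.
Context (g : T2 -> B) (nabla : Omega1 -> T2).
Context (gr : right_functional g).
Context (gE : forall a, g (tensor_comb e a) = \sum_(i < 2) a i i).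
Context (Gam : 'I_2 -> 'I_2 -> 'I_2 -> B).
Context (nablaE : forall i, nabla (e i) = tensor_comb e (Gam i)).
Context (LC : is_levi_civita g nabla).

(** A metric obtained by choice is known only through its specification; the values in [gE] already
    determine it, since every tensor is a combination of the basis. *)
Lemma metric_trace x : g x = trace_metric x.
Proof. by rewrite -(tensor_coordK eb x) gE trace_metric_comb. Qed.

(** Torsion-freeness together with d(e_p) = 0 puts [nabla (e p)] in the kernel of the wedge. *)
Lemma christoffel_sym p i j : Gam p i j = Gam p j i.
Proof.
have [_ tf _] := LC; have := tf (e p).
rewrite (d1_basis rt) addr0 nablaE => /wedge_eq0P/(_ i j).
by rewrite !tensor_coord_comb.
Qed.

(** The maps composing [Pi_metric] are lifts evaluated at chosen representatives. Balancedness of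
    each, shown here and in the next lemmas, allows computing them on elementary tensors. *)
Lemma append_balanced (h : Omega1) :
  balanced (@ract K B Omega1) (@lact K B Omega1) (fun u v => u ⊗ v ⊗ h).
Proof.
have [Dl Dr Mm] := btens_balanced Omega1 T2.
have [Dl' Dr' Mm'] := btens_balanced Omega1 Omega1.
split=> [u u' v|u v v'|u a v]; first by rewrite Dl.
  by rewrite Dl' Dr.
by rewrite Mm [lact a (v ⊗ h)]bitensor_lact_tens.
Qed.

Lemma sigma23_balanced : balanced (@ract K B Omega1) (@lact K B T2)
  (fun u (x : T2) => u ⊗ sigma x).
Proof.
have [Dl Dr Mm] := btens_balanced Omega1 T2.
split=> [u u' v|u v v'|u a v]; first by rewrite Dl.
  by rewrite sigmaD Dr.
by rewrite Mm sigma_lact.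
Qed.

Lemma metric_id_balanced1 u : balanced (@ract K B Omega1) (@lact K B Omega1)
  (fun v w : Omega1 => lact (g (u ⊗ v)) w).
Proof.
have [gD gR] := gr; have [Dl Dr Mm] := btens_balanced Omega1 Omega1.
split=> [v v' w|v w w'|v a w]; first by rewrite Dr gD lactDl.
  by rewrite lactDr.
by rewrite lactA -gR [ract (u ⊗ v) a]bitensor_ract_tens.
Qed.

Lemma metric_id_balanced2 : balanced (@ract K B Omega1) (@lact K B T2)
  (fun u => tens_lift (fun v w : Omega1 => lact (g (u ⊗ v)) w)).
Proof.
have [gD gR] := gr; have [Dl Dr Mm] := btens_balanced Omega1 Omega1.
have bal1 := metric_id_balanced1.
split=> [u u' x|u x x'|u a x]; last 2 first.
- exact: tens_liftD.
- apply: (tens_ext (f := tens_lift (fun v w : Omega1 => lact (g (ract u a ⊗ v)) w))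
   (g := fun x => tens_lift (fun v w : Omega1 => lact (g (u ⊗ v)) w)
           (lact a (x : T2)))) x => [x y|x y|v w].
  + exact: tens_liftD.
  + rewrite -tens_liftD //; congr (tens_lift _ _).
    exact: (bitensor_lactDr a x y).
  rewrite -[tens _ _ v w]/(v ⊗ w) [lact a (v ⊗ w)]bitensor_lact_tens.
  by rewrite !(tens_lift_tens _ _ (bal1 _)) Mm.
apply: (tens_ext
  (f := tens_lift (fun v w : Omega1 => lact (g ((u + u') ⊗ v)) w))
  (g := fun x => tens_lift (fun v w : Omega1 => lact (g (u ⊗ v)) w) x +
          tens_lift (fun v w : Omega1 => lact (g (u' ⊗ v)) w) x)) x
  => [x y|x y|v w].
- exact: tens_liftD.
- by rewrite !tens_liftD // addrACA.
- by rewrite !(tens_lift_tens _ _ (bal1 _)) Dl gD lactDl.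
Qed.

(** On e_j ⊗ e_l a, the coefficient a passes the appended central form e_q, [sigma] exchanges e_l
    and e_q, and the metric contracts e_j with e_q, leaving e_l a when j = q and 0 otherwise. *)
Lemma Pi_metric_term q (x : T2) :
  metric_id g (sigma23 (tensor_append x (e q))) =
  comb e (fun l => tcoord q l x).
Proof.
pose f (x : T2) := metric_id g (sigma23 (tensor_append x (e q))).
have fD : {morph f : x y / x + y}.
  move=> y z; rewrite /f /tensor_append /sigma23 /metric_id.
  rewrite (tens_liftD _ _ (append_balanced _)) (tens_liftD _ _ sigma23_balanced).
  by rewrite (tens_liftD _ _ metric_id_balanced2).
have fT j l a :
    f (ract (e j ⊗ e l) a) = lact (j == q)%:R (ract (e l) a).
  rewrite /f [ract _ _]bitensor_ract_tens.
  rewrite /tensor_append (tens_lift_tens _ _ (append_balanced _)).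
  rewrite /sigma23 (tens_lift_tens _ _ sigma23_balanced).
  rewrite (balancedM (btens_balanced Omega1 Omega1)) (basis_central eb).
  have := sigma_ract (e l ⊗ e q) a.
  rewrite [ract (_ ⊗ _) a]bitensor_ract_tens => ->.
  rewrite sigma_basis [ract (_ ⊗ _) a]bitensor_ract_tens.
  rewrite /metric_id (tens_lift_tens _ _ metric_id_balanced2).
  rewrite (tens_lift_tens _ _ (metric_id_balanced1 _)).
  by rewrite metric_trace trace_metric_tens_basis bcoord_basis.
rewrite -/(f x) -{1}(tensor_coordK eb x) (additive_sum fD) (bigD1 q) //=.
rewrite (additive_sum fD) [X in _ + X]big1 => [|j /negbTE jq].
  by rewrite addr0; apply: eq_bigr => l _; rewrite fT eqxx lact1.
rewrite (additive_sum fD) big1 // => l _; rewrite fT jq.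
by apply: (addIr (lact 0 (ract (e l) (tcoord j l x)))); rewrite -lactDl !add0r.
Qed.

Lemma d0_scalar (c : K) : d0 Omega c%:A = 0.
Proof.
have d1 : d0 Omega 1 = 0.
  apply: (addIr (d0 Omega 1)); rewrite add0r.
  by have := d0M Omega 1 1; rewrite mulr1 ract1 lact1 => <-.
have d00 : d0 Omega 0 = 0.
  apply: (addIr (d0 Omega 0)); rewrite add0r.
  by have := d0_linear Omega 1 0 0; rewrite scaler0 addr0 scale1r lact1 => <-.
by have := d0_linear Omega c 1 0; rewrite !addr0 d1 d00 addr0 lact0r.
Qed.

(** Metric compatibility is tested on basis forms with a = 1: both differentials are then of
    constants, and the two contractions must cancel. *)
Lemma christoffel_skew p q l : Gam p q l = - Gam q p l.
Proof.
have [_ _ mc] := LC.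
have ec i : e i \in @central K B Omega1 := basis_in_central eb i.
have := mc (exist _ (e p) (ec p)) (exist _ (e q) (ec q)) 1.
rewrite /Pi_metric /= !ract1 metric_trace trace_metric_tens_basis bcoord_basis.
have -> : ((p == q)%:R : B) = ((p == q)%:R : K)%:A by rewrite scaler_nat.
have := d0_scalar 1; rewrite scale1r => ->.
rewrite d0_scalar lact0r addr0 !nablaE => h.
apply/eqP; rewrite -addr_eq0.
have sD : metric_id g (sigma23
   (tensor_append (tensor_comb e (Gam p)) (e q)
    + tensor_append (tensor_comb e (Gam q)) (e p))) =
  comb e (fun l => Gam p q l + Gam q p l).
  rewrite /sigma23 (tens_liftD _ _ sigma23_balanced).
  rewrite /metric_id (tens_liftD _ _ metric_id_balanced2).
  rewrite [X in X + _]Pi_metric_term [X in _ + X]Pi_metric_term -combD.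
  by apply: eq_comb => i; rewrite !tensor_coord_comb.
by rewrite sD in h; rewrite (comb_free eb h).
Qed.

(* The symbols are symmetric in the last two indices and skew in the first
   two, as in the uniqueness proof of the classical Levi-Civita connection. *)
Lemma christoffel_eq0 p i j : Gam p i j = 0.
Proof.
apply: (oppr_fixed_eq0 two_neq0).
rewrite {1}(christoffel_skew p i j) (christoffel_sym i p j).
rewrite (christoffel_skew i j p) (christoffel_sym j i p).
by rewrite (christoffel_skew j p i) (christoffel_sym p j i) opprK.
Qed.

End LeviCivita.
End RankTwoCalculus.

(** * Connes' calculus for a Dirac operator with two gamma operators *)

Section RankTwoDirac.
Context (K : fieldType) (two_neq0 : 2%:R != 0 :> K) (B : algType K).
Context (X : dirac_module B) (del : 'I_2 -> {linear B -> B}).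
Local Notation V := (dm_space X).
Local Notation act := (dm_act X).
Context (gam : 'I_2 -> V -> V) (s t : 'I_2 -> B).
Context (commE : forall a v,
  comm a v = \sum_(m < 2) act (del m a) (gam m v)).
Context (gamD : forall m, {morph gam m : u v / u + v}).
Context (gam_act : forall m a v, gam m (act a v) = act a (gam m v)).
Context (gam_sq : forall m v, gam m (gam m v) = v).
Context (gam_anti : forall v,
  gam ord0 (gam ord_max v) = - gam ord_max (gam ord0 v)).
Context (act_faithful : forall a, (forall v, act a v = 0) -> a = 0).
Context (delM : forall m a b, del m (a * b) = del m a * b + a * del m b).
Context (delC : forall a,
  del ord0 (del ord_max a) = del ord_max (del ord0 a)).
Context (ts1 : forall i, t i * s i = 1).
Context (del_s : forall m i, del m (s i) = (m == i)%:R *: s m).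
Context (del_t : forall m i, del m (t i) = - ((m == i)%:R *: t i)).

Let act0 v : act 0 v = 0.
Proof. by apply: (addIr (act 0 v)); rewrite -dm_actD !add0r. Qed.

Let actN a v : act (- a) v = - act a v.
Proof. by apply: (addIr (act a v)); rewrite -dm_actD !addNr act0. Qed.

Let act_suml I (r : seq I) F v :
  act (\sum_(i <- r) F i) v = \sum_(i <- r) act (F i) v.
Proof. by apply: (big_morph (act^~ v)) => // a b; rewrite dm_actD. Qed.

Let gam0r m : gam m 0 = 0.
Proof. by apply: (addIr (gam m 0)); rewrite -gamD !add0r. Qed.

(* Conjugation by [gam ord0] fixes the first operator and negates the second. *)
Lemma gam_conj_free (f g : V -> V) :
  (forall v, f v + g v = 0) ->
  (forall v, gam ord0 (f (gam ord0 v)) = f v) ->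
  (forall v, gam ord0 (g (gam ord0 v)) = - g v) ->
  (forall v, f v = 0) /\ (forall v, g v = 0).
Proof.
move=> fg0 fP gP.
have g0 v : g v = 0.
  apply: (oppr_fixed_eq0 two_neq0).
  have := congr1 (gam ord0) (fg0 (gam ord0 v)).
  rewrite gamD fP gP gam0r -(fg0 v) => /addrI.
  by move/esym.
by split=> // v; have := fg0 v; rewrite g0 addr0.
Qed.

Lemma gam_free a b :
  (forall v, act a (gam ord0 v) + act b (gam ord_max v) = 0) -> a = 0 /\ b = 0.
Proof.
move=> ab.
have [v|v|fa gb] := gam_conj_free ab.
- by rewrite gam_act !gam_sq.
- by rewrite gam_act gam_anti gam_sq linearN.
split; apply: act_faithful => v.
  by rewrite -[v](gam_sq ord0) fa.
by rewrite -[v](gam_sq ord_max) gb.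
Qed.

(** Conjugation by gamma_1 fixes the scalar term and negates the other. Only [b] is extracted:
    scalar operators arise as junk, so the gamma_1 gamma_2 component is what survives in degree
    two. *)
Lemma gam_prod_free a b :
  (forall v, act a v + act b (gam ord0 (gam ord_max v)) = 0) -> b = 0.
Proof.
move=> ab; have [v|v|fa gb] := gam_conj_free ab.
- by rewrite gam_act gam_sq.
- by rewrite gam_act gam_sq gam_anti linearN opprK.
apply: act_faithful => v.
(* The operator gamma_2 gamma_1 is inverse to gamma_1 gamma_2. *)
by have := gb (gam ord_max (gam ord0 v)); rewrite !gam_sq.
Qed.

Lemma comm_single i a b (v : V) : del i a = b -> (forall m, m != i -> del m a = 0) ->
  comm a v = act b (gam i v).
Proof.
move=> ab a0; rewrite commE (bigD1 i) //= ab big1 ?addr0 // => m /a0 ->.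
by rewrite act0.
Qed.

Lemma comm_s i (v : V) : comm (s i) v = act (s i) (gam i v).
Proof.
apply: comm_single => [|m /negbTE mi]; first by rewrite del_s eqxx scale1r.
by rewrite del_s mi scale0r.
Qed.

Lemma comm_t i (v : V) : comm (t i) v = - act (t i) (gam i v).
Proof.
rewrite -actN; apply: comm_single => [|m /negbTE mi].
  by rewrite del_t eqxx scale1r.
by rewrite del_t mi scale0r oppr0.
Qed.

Lemma act_ts i v : act (t i) (act (s i) v) = v.
Proof. by rewrite -dm_actM ts1 dm_act1. Qed.

Lemma Pi_rep_word1 (a b : B) (v : V) :
  Pi_rep [:: (a, [tuple b])] v = act a (comm b v).
Proof. by rewrite Pi_repE big_seq1. Qed.

Lemma Pi_delta_word1 (a b : B) (v : V) :
  Pi_rep (delta_rep [:: (a, [tuple b])]) v = comm a (comm b v).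
Proof. by rewrite Pi_deltaE big_seq1. Qed.

Lemma Pi_rep_gam m : Pi_rep [:: (t m, [tuple s m])] = gam m.
Proof. by apply/funext => v; rewrite Pi_rep_word1 comm_s act_ts. Qed.

Lemma gam_form m : gam m \in forms 1.
Proof. by apply/asboolP; exists [:: (t m, [tuple s m])]; rewrite Pi_rep_gam. Qed.

Definition gam_op m : form_op X 1 := Sub (gam m) (gam_form m).

Local Notation e := (fun m => op_class 1 (gam m) : form1 (connes_calculus X)).

(** Membership of [gam m] in the one-forms excludes the default value 0 of [op_class]. *)
Lemma op_class_gam m : op_class 1 (gam m) = form_class (gam_op m).
Proof.
by congr form_class; apply: val_inj; rewrite insubdK //; apply: gam_form.
Qed.

Lemma form_class0 k : form_class (0 : form_op X k) = 0.
Proof. by rewrite /form_class raddf0. Qed.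

Lemma form_class_eq0 k (T : form_op X k) :
  form_class T = 0 <-> junk_op k (val T).
Proof. by rewrite -form_class0 form_classP -raddfB subr0. Qed.

Lemma commA a (v : V) : comm a v =
  act (del ord0 a) (gam ord0 v) + act (del ord_max a) (gam ord_max v).
Proof. by rewrite commE sum_I2. Qed.

(** For the span, a db is the sum of the e_m a del_m(b). For freeness, [junk1] shows that degree one
    has no junk, so a relation between classes is one between operators and [gam_free] applies. *)
Lemma rank_two_dirac_basis : central_basis e.
Proof.
split=> [i a|x|a].
- rewrite op_class_gam [LHS]cform_lactE [RHS]cform_ractE.
  by apply: form_class_eq => v /=; rewrite gam_act.
- have [r ->] := cform1_gen x.
  exists (fun i => \sum_(p <- r) p.1 * del i p.2).
  rewrite /comb (eq_bigr (fun i => \sum_(p <- r) ract (e i) (p.1 * del i p.2)));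
    last by move=> i _; rewrite (additive_sum (ractDr (e i))).
  rewrite exchange_big; apply: eq_bigr => -[a b] _ /=.
  rewrite sum_I2 !op_class_gam [lact _ _]cform_lactE.
  rewrite ![ract _ _]cform_ractE -[RHS]form_classD.
  apply: form_class_eq => v /=; rewrite commA linearD /= -!dm_actM.
  by rewrite [RHS]/GRing.add /= !gam_act.
rewrite /comb sum_I2 !op_class_gam ![ract _ _]cform_ractE -[X in X = _]form_classD.
move=> /form_class_eq0/junk1 a0.
have [] := @gam_free (a ord0) (a ord_max).
  move=> v; rewrite -!gam_act; exact: (congr1 (@^~ v) a0).
by move=> ? ? i; case: (I2_cases i) => ->.
Qed.

(* Witness: the universal form [t ds - (1/2) t^2 d(s^2)] is represented by zero.
   The weights of [s^2] and [t^2] being doubled, its differential is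
   represented by -1 + 2 = 1. *)
Lemma id_junk : @junk_op K B X 2 id.
Proof.
pose x := s ord0; pose y := t ord0; pose z := - (2^-1 *: (y * y)).
have dxx : del ord0 (x * x) = x * x + x * x.
  by rewrite delM del_s eqxx scale1r.
have dyy : del ord0 (y * y) = - (y * y + y * y).
  by rewrite delM del_t eqxx scale1r mulNr mulrN opprD.
have dxx0 m : m != ord0 -> del m (x * x) = 0.
  by move=> /negbTE m0; rewrite delM del_s m0 scale0r mul0r mulr0 addr0.
have dyy0 m : m != ord0 -> del m (y * y) = 0.
  by move=> /negbTE m0; rewrite delM del_t m0 scale0r oppr0 mul0r mulr0 addr0.
have dz : del ord0 z = y * y.
  by rewrite linearN linearZ /= dyy scalerN opprK scale_half_double.
have dz0 m : m != ord0 -> del m z = 0.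
  by move=> m0; rewrite linearN linearZ /= dyy0 // scaler0 oppr0.
have yyxx : y * y * (x * x) = 1.
  by rewrite mulrA -(mulrA y) ts1 mulr1 ts1.
exists [:: (y, [tuple x]); (z, [tuple x * x])]; split; apply/funext => v.
  rewrite Pi_repE big_cons big_seq1 /= comm_s act_ts.
  rewrite (comm_single _ dxx dxx0) -dm_actM.
  have -> : z * (x * x + x * x) = - 1.
    by rewrite mulNr -scalerAl mulrDr yyxx scale_half_double.
  by rewrite actN dm_act1 subrr.
rewrite Pi_deltaE big_cons big_seq1 /= comm_s comm_t gam_act gam_sq act_ts.
rewrite (comm_single _ dxx dxx0) (comm_single _ dz dz0) gam_act gam_sq -dm_actM.
by rewrite mulrDr yyxx dm_actD dm_act1 addrA addNr add0r.
Qed.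

(** If the sum w of terms a δb is represented by zero, then each sum of a del_m(b) vanishes.
    Differentiating it turns the sum of del_m(a) del_n(b) into minus the sum of a del_m(del_n(b)),
    which is symmetric in m and n. *)
Lemma rank_two_dirac_volume_free a :
  ract (wedge (e ord0) (e ord_max)) a = 0 -> a = 0.
Proof.
cbv beta; rewrite !op_class_gam [wedge _ _]cform_wedgeE [ract _ _]cform_ractE.
move=> /form_class_eq0 [w [w0 aw]].
pose b (p : B * 1.-tuple B) := thead p.2.
have commp (p : B * 1.-tuple B) v : comm_prod p.2 v = comm (b p) v.
  by rewrite /b; case: p => c r /=; case: (tupleP r) => d r'; rewrite (tuple0 r').
pose c m := \sum_(p <- w) p.1 * del m (b p).
have [c0 c1] : c ord0 = 0 /\ c ord_max = 0.
  apply: gam_free => v; rewrite -[RHS]/((0 : V -> V) v) -w0 Pi_repE.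
  rewrite !act_suml -big_split; apply: eq_bigr => p _ /=.
  by rewrite commp commA linearD /= -!dm_actM.
pose d m n := \sum_(p <- w) del m p.1 * del n (b p).
have dE m n : d m n = del m (c n) - \sum_(p <- w) p.1 * del m (del n (b p)).
  rewrite linear_sum -sumrB; apply: eq_bigr => p _.
  by rewrite delM addrK.
have d01 : d ord0 ord_max = d ord_max ord0.
  rewrite !dE c0 c1 !linear0; congr (_ - _).
  by apply: eq_bigr => p _; rewrite delC.
(* Equal indices contribute scalars since gamma_m squares to 1; the mixed terms cancel by
   anticommutation and the symmetry of [d]. *)
have dw v : Pi_rep (delta_rep w) v = act (d ord0 ord0 + d ord_max ord_max) v.
  transitivity (act (d ord0 ord0) v + act (d ord_max ord_max) v +
    (act (d ord0 ord_max) (gam ord0 (gam ord_max v)) +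
     act (d ord_max ord0) (gam ord_max (gam ord0 v)))).
    rewrite Pi_deltaE !act_suml -!big_split; apply: eq_bigr => p _ /=.
    rewrite commp commA [X in gam _ X]commA [X in _ + act _ (gam _ X)]commA.
    rewrite !gamD !gam_act !linearD /= -!dm_actM !gam_sq.
    by rewrite [X in _ + X]addrC addrACA.
  by rewrite gam_anti linearN /= d01 addNr addr0 dm_actD.
(* The sign puts Pi(δw) - a gamma_1 gamma_2 = 0 into the shape of [gam_prod_free]. *)
apply/eqP; rewrite -oppr_eq0; apply/eqP.
apply: (@gam_prod_free (d ord0 ord0 + d ord_max ord_max)) => v.
rewrite -dw -aw /= actN -!gam_act.
by rewrite subrr.
Qed.

(** The forms e_i /\ e_i and - d(e_i) are both the class of the identity operator, which is junk by
    [id_junk]. Anticommutation already holds for the operators. *)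
Lemma rank_two_dirac : rank_two e.
Proof.
split.
- exact: rank_two_dirac_basis.
- move=> i; rewrite op_class_gam [LHS]cform_wedgeE; apply/form_class_eq0.
  rewrite (_ : val _ = id); first exact: id_junk.
  by apply/funext => v /=.
- apply: (addIr (wedge (e ord0) (e ord_max))); rewrite addNr !op_class_gam.
  rewrite ![wedge _ _]cform_wedgeE -[LHS]form_classD -[RHS]form_class0.
  apply: form_class_eq => v /=.
  by rewrite [LHS]/GRing.add /= gam_anti addrN.
- exact: rank_two_dirac_volume_free.
move=> i; rewrite op_class_gam.
rewrite [LHS](@cform_dE _ _ _ _ _ [:: (t i, [tuple s i])]); last first.
  by rewrite Pi_rep_gam.
apply/form_class_eq0; have [j0 jB] := junk_op_closed X 2.
rewrite (_ : val _ = 0 - id); first by apply: jB => //; exact: id_junk.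
apply/funext => v /=; rewrite Pi_delta_word1 comm_t comm_s gam_act gam_sq.
by rewrite act_ts sub0r.
Qed.

End RankTwoDirac.

(** * The canonical calculus of rank two and its integral at k = 1 *)

Section CanonicalCalculus.
Context (R : realType) (A : cstarAlgType R) (S : 'I_2 -> A).
Context (tau0 : faithful_state A) (L : gns tau0).
Context (del : 'I_2 -> {linear smooth S -> smooth S}).
Context (gamma : 'I_2 -> 'M[R[i]]_2).
Context (S_isometry : forall i, is_isometry (S i)).
Context (del_derivation : forall i, derivation (del i)).
Context (del_gen : forall i j,
  del i (smooth_gen S j) = (i == j)%:R *: smooth_gen S i).
Context (del_gen_star : forall i j,
  del i (smooth_star (smooth_gen S j)) =
  - ((i == j)%:R *: smooth_star (smooth_gen S j))).
Context (gamma_sq : forall i, gamma i *m gamma i = 1%:M).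
Context (gamma_anticomm :
  gamma ord0 *m gamma ord_max = - (gamma ord_max *m gamma ord0)).
Local Notation B := (smooth S).
Local Notation X := (canonical_module L del gamma).
Local Notation V := (dirac_dom S L).
Implicit Types (a b : B) (v : V).

(** Operator identities on the domain are checked on coordinates in [B], which are well determined
    because tau0 is faithful. *)
Lemma spinor_coord_ext v w :
  (forall j, spinor_coord v j = spinor_coord w j) -> v = w.
Proof.
by move=> vw; apply: dirac_dom_ext => j; rewrite !spinor_coordP vw.
Qed.

Lemma spinor_coordD v w j :
  spinor_coord (v + w) j = spinor_coord v j + spinor_coord w j.
Proof. by have := spinor_coord_linear 1 v w j; rewrite !scale1r. Qed.

Lemma spinor_coord0 j : spinor_coord (0 : V) j = 0.
Proof.
apply: (addIr (spinor_coord (0 : V) j)); rewrite add0r.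
by have := spinor_coord_linear 1 (0 : V) 0 j; rewrite scale1r addr0 scale1r => <-.
Qed.

Lemma spinor_coordN v j : spinor_coord (- v) j = - spinor_coord v j.
Proof.
have := spinor_coord_linear (-1) v 0 j.
by rewrite !scaleN1r addr0 spinor_coord0 addr0.
Qed.

Lemma spinor_coord_act a v j :
  spinor_coord (act_op a v) j = a * spinor_coord v j.
Proof.
apply/val_inj/(@L2_class_inj _ _ _ L); rewrite -spinor_coordP SubK ffunE.
by rewrite spinor_coordP L2_act_class.
Qed.

Lemma spinor_coord_gamma m v i :
  spinor_coord (gamma_op gamma m v) i =
  \sum_(j < 2) gamma m i j *: spinor_coord v j.
Proof.
apply/val_inj/(@L2_class_inj _ _ _ L); rewrite -spinor_coordP SubK ffunE.
rewrite raddf_sum /= raddf_sum /=; apply: eq_bigr => j _.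
by rewrite linearZ /= spinor_coordP.
Qed.

Lemma spinor_coord_dirac v i :
  spinor_coord (dirac_op del gamma v) i =
  \sum_(m < 2) \sum_(j < 2) gamma m i j *: del m (spinor_coord v j).
Proof. exact: spinor_coordK. Qed.

(** In each coordinate the Leibniz rule leaves only the term in which [a] is differentiated; scalar
    gamma entries pass through. *)
Lemma canonical_comm a v : @comm _ _ X a v =
  \sum_(m < 2) act_op (del m a) (gamma_op gamma m v) :> V.
Proof.
apply: spinor_coord_ext => i.
rewrite -[@comm _ _ X a v]/(dirac_op del gamma (act_op a v)
  - act_op a (dirac_op del gamma v)).
rewrite spinor_coordD spinor_coordN spinor_coord_act.
rewrite [in RHS]sum_I2 spinor_coordD !spinor_coord_act !spinor_coord_dirac.
rewrite mulr_sumr -sumrB [LHS]sum_I2; congr (_ + _);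
  rewrite spinor_coord_gamma !mulr_sumr -sumrB; apply: eq_bigr => j _;
  by rewrite spinor_coord_act del_derivation scalerDr -!scalerAr addrK.
Qed.

Lemma gamma_opD m : {morph gamma_op gamma m : u v / u + v : V}.
Proof.
move=> u v; apply: spinor_coord_ext => i.
rewrite spinor_coordD !spinor_coord_gamma -big_split.
by apply: eq_bigr => j _; rewrite spinor_coordD scalerDr.
Qed.

Lemma gamma_op_act m a v :
  gamma_op gamma m (act_op a v) = act_op a (gamma_op gamma m v).
Proof.
apply: spinor_coord_ext => i.
rewrite spinor_coord_act !spinor_coord_gamma mulr_sumr.
by apply: eq_bigr => j _; rewrite spinor_coord_act scalerAr.
Qed.

Lemma spinor_coord_gamma2 m n v i :
  spinor_coord (gamma_op gamma m (gamma_op gamma n v)) i =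
  \sum_(j < 2) (gamma m *m gamma n) i j *: spinor_coord v j.
Proof.
rewrite spinor_coord_gamma.
under eq_bigr do rewrite spinor_coord_gamma scaler_sumr.
rewrite exchange_big; apply: eq_bigr => j _ /=.
by rewrite mxE scaler_suml; apply: eq_bigr => k _; rewrite scalerA.
Qed.

Lemma gamma_op_sq m v : gamma_op gamma m (gamma_op gamma m v) = v.
Proof.
apply: spinor_coord_ext => i; rewrite spinor_coord_gamma2 gamma_sq.
rewrite (bigD1 i) //= mxE eqxx scale1r big1 ?addr0 // => j /negbTE ij.
by rewrite mxE eq_sym ij scale0r.
Qed.

Lemma gamma_op_anti v :
  gamma_op gamma ord0 (gamma_op gamma ord_max v) =
  - gamma_op gamma ord_max (gamma_op gamma ord0 v).
Proof.
apply: spinor_coord_ext => i; rewrite spinor_coordN !spinor_coord_gamma2.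
rewrite gamma_anticomm -sumrN; apply: eq_bigr => j _.
by rewrite mxE scaleNr.
Qed.

Lemma act_op_faithful a : (forall v, act_op a v = 0 :> V) -> a = 0.
Proof.
(* The constant spinor 1 recovers [a] as a coordinate of its image. *)
move=> a0; have := spinor_coord_act a (spinor L (fun=> 1)) ord0.
rewrite a0 spinor_coordK mulr1 => <-.
exact: spinor_coord0.
Qed.

(* The commutator of the derivations is a derivation that kills the generators
   and their adjoints. *)
Lemma smooth_derC a : del ord0 (del ord_max a) = del ord_max (del ord0 a).
Proof.
pose Q (b : B) := del ord0 (del ord_max b) = del ord_max (del ord0 b).
have Q1 : Q 1.
  have del1 i : del i 1 = 0.
    apply: (addIr (del i 1)); rewrite add0r.
    by have := del_derivation i 1 1; rewrite !mulr1 mul1r => <-.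
  by rewrite /Q !del1 !linear0.
have QD b c : Q b -> Q c -> Q (b + c) by rewrite /Q !linearD => -> ->.
have QZ k b : Q b -> Q (k *: b) by rewrite /Q !linearZ /= => ->.
have QM b c : Q b -> Q c -> Q (b * c).
  rewrite /Q !del_derivation !linearD !del_derivation /= => -> ->.
  by rewrite -!addrA; congr (_ + _); rewrite addrCA; do 2!congr (_ + _).
pose mk x (h : x \in smooth_pred S) : B := Sub x h.
(* The adjoint constructor of [star_gen] makes the induction carry x and its adjoint together; that
   constructor then merely exchanges the two statements. *)
pose P x := forall h : x \in smooth_pred S,
  Q (mk x h) /\ Q (smooth_star (mk x h)).
have PP x : star_gen S x -> P x.
  have sg y : star_gen S y -> y \in smooth_pred S by move/asboolP.
  elim=> {x} [i||x y xg IHx yg IHy|c x xg IHx|x y xg IHx yg IHy|x xg IHx] h.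
  - rewrite (_ : mk _ h = smooth_gen S i); last exact: val_inj.
    rewrite /Q !(del_gen, del_gen_star, linearN, linearZ) /=.
    by case: (I2_cases i) => ->; rewrite /= !(scale0r, scaler0, oppr0, linear0).
  - rewrite (_ : mk _ h = 1); last exact: val_inj.
    rewrite (_ : smooth_star 1 = 1) //; apply: val_inj => /=.
    by rewrite -[LHS]mulr1 -{2}[1]starK -starM mulr1 starK.
  - have [[q qs] [r rs]] := (IHx (sg _ xg), IHy (sg _ yg)).
    rewrite (_ : mk _ h = mk x (sg _ xg) + mk y (sg _ yg)); last exact: val_inj.
    split; first exact: QD.
    rewrite (_ : smooth_star _ = smooth_star (mk x (sg _ xg)) +
      smooth_star (mk y (sg _ yg))); first exact: QD.
    by apply: val_inj; rewrite /= starD.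
  - have [q qs] := IHx (sg _ xg).
    rewrite (_ : mk _ h = c *: mk x (sg _ xg)); last exact: val_inj.
    split; first exact: QZ.
    rewrite (_ : smooth_star _ = Num.conj c *: smooth_star (mk x (sg _ xg)));
      first exact: QZ.
    by apply: val_inj; rewrite /= starZ.
  - have [[q qs] [r rs]] := (IHx (sg _ xg), IHy (sg _ yg)).
    rewrite (_ : mk _ h = mk x (sg _ xg) * mk y (sg _ yg)); last exact: val_inj.
    split; first exact: QM.
    rewrite (_ : smooth_star _ = smooth_star (mk y (sg _ yg)) *
      smooth_star (mk x (sg _ xg))); first exact: QM.
    by apply: val_inj; rewrite /= starM.
  have [q qs] := IHx (sg _ xg).
  rewrite (_ : mk _ h = smooth_star (mk x (sg _ xg))); last exact: val_inj.
  split=> //; rewrite (_ : smooth_star _ = mk x (sg _ xg)) //.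
  by apply: val_inj; rewrite /= starK.
have /asboolP/PP/(_ (valP a))[] := valP a.
by rewrite (_ : mk _ _ = a) //; apply: val_inj.
Qed.

(** The adjoint of S_i serves as the left inverse [t i]: S_i is an isometry, and the derivations
    give its adjoint the opposite weight. *)
Lemma canonical_rank_two : rank_two (basis_form L del gamma).
Proof.
apply: (@rank_two_dirac _ _ _ X del (gamma_op gamma) (smooth_gen S)
  (fun i => smooth_star (smooth_gen S i))).
- by rewrite pnatr_eq0.
- exact: canonical_comm.
- exact: gamma_opD.
- exact: gamma_op_act.
- exact: gamma_op_sq.
- exact: gamma_op_anti.
- exact: act_op_faithful.
- by move=> m a b; apply: del_derivation.
- exact: smooth_derC.
- by move=> i; apply: val_inj; apply: S_isometry.
- by move=> m i; rewrite del_gen.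
- by move=> m i; rewrite del_gen_star.
Qed.

Local Notation Omega := (canonical_calculus L del gamma).
Local Notation T2 := (bitensor (form1 Omega) (form1 Omega)).

Let two_neq0 : 2%:R != 0 :> R[i]. Proof. by rewrite pnatr_eq0. Qed.

(** The trace metric meets the specification at k = 1, so the metric picked by [xget] meets it as
    well. *)
Lemma deformed_metric1 : let g := @deformed_metric _ _ _ _ L del gamma 1 in
  right_functional g /\
  forall c, g (tensor_coords L del gamma c) = \sum_(i < 2) c i i.
Proof.
pose Q := [set g : T2 -> B |
    [/\ pseudo_riemannian g, strongly_sigma_compatible g
      & forall c, g (tensor_coords L del gamma c) = \sum_(i < 2) 1 * c i i]]%classic.
have /(@xgetPex _ (fun=> 0) Q) [[gr _ _ _] _ gE] : exists g, Q g.
  exists (trace_metric canonical_rank_two); split.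
  - exact: trace_metric_riemannian.
  - exact: trace_metric_compatible.
  move=> c; rewrite [LHS]trace_metric_comb.
  by apply: eq_bigr => i _; rewrite mul1r.
by split=> // c; rewrite [LHS]gE; apply: eq_bigr => i _; rewrite mul1r.
Qed.

Lemma christoffel1_eq0 i j l :
  christoffel (levi_civita (@deformed_metric _ _ _ _ L del gamma 1)) i j l = 0.
Proof.
have [gr gE] := deformed_metric1; set g := deformed_metric 1 in gr gE *.
pose eb : central_basis (basis_form L del gamma) := canonical_rank_two.
(* The default value of [christoffel] is already zero. *)
rewrite /christoffel; case: xgetP => [Gam _ /= nablaE|//].
rewrite /levi_civita in nablaE.
case: xgetP nablaE => [nabla _ LC|_] nablaE.
  exact: (christoffel_eq0 two_neq0 canonical_rank_two gr gE nablaE LC).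
(* In the default branch of [levi_civita] the connection is the zero map, so its symbols are the
   coordinates of the zero tensor. *)
rewrite -(tensor_coord_comb eb (Gam i)).
rewrite -[tensor_comb _ _](nablaE i).
by apply: (addIr (tensor_coord eb j l 0)); rewrite -tensor_coordD !add0r.
Qed.

Lemma integral2_curvature1 (tau : {scalar A}) :
  integral2 tau (curvature12 L del gamma 1) = 0.
Proof.
rewrite /integral2 /curvature12 !sum_I2 !christoffel1_eq0.
rewrite !linear0 !mul0r subrr !addr0.
(* Freeness of the volume form forces the coefficient 0, which is also the default. *)
case: xgetP => [c _ /= /(volume_inj canonical_rank_two) <-|_];
  by rewrite !raddf0.
Qed.

End CanonicalCalculus.

Theorem proposition5p8 (R : realType) (A : cstarAlgType R) (tau : {scalar A})
    (S : 'I_2 -> A) (del : 'I_2 -> {linear smooth S -> smooth S})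
    (tau0 : faithful_state A) (L : gns tau0) (gamma : 'I_2 -> 'M[R[i]]_2)
    (tau_state : is_state tau) (tau_tracial : tracial tau)
    (S_isometry : forall i, is_isometry (S i))
    (S_generate : cdense (star_gen S))
    (del_derivation : forall i, derivation (del i))
    (del_gen : forall i j,
       del i (smooth_gen S j) = (i == j)%:R *: smooth_gen S i)
    (del_gen_star : forall i j,
       del i (smooth_star (smooth_gen S j)) =
       - ((i == j)%:R *: smooth_star (smooth_gen S j)))
    (gamma_sq : forall i, gamma i *m gamma i = 1%:M)
    (gamma_anticomm :
       gamma ord0 *m gamma ord_max = - (gamma ord_max *m gamma ord0)) :
  (forall k k' : smooth S,
     deformation_parameter k -> deformation_parameter k' ->
     integral2 tau (curvature12 L del gamma k) =
     integral2 tau (curvature12 L del gamma k')) ->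
  forall k : smooth S, deformation_parameter k ->
    integral2 tau (curvature12 L del gamma k) = 0.
Proof.
move=> indep k kP.
rewrite (indep k 1 kP); last by exists 1; rewrite !mulr1.
exact: integral2_curvature1.
Qed.
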